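(* Consider a state-dependent discrete memoryless channel $W_{Y,Z|X,S}$ with finite alphabets, i.i.d. state distribution $Q_S$, innocent symbol $x_0$, and non-causal channel state information available only at the transmitter (encoder $(M,S^n)\mapsto X^n$, decoder $Y^n\mapsto\hat M$). Let $\mathcal D$ be the set of joint pmfs $$P_{U,V,S,X,Y,Z}=P_UP_VP_{S|U,V}\mathbb 1_{\{X=x(U,S)\}}W_{Y,Z|X,S},$$ where $U,V$ are auxiliary random variables on finite alphabets with $|\mathcal U|\le|\mathcal X|+5$, $|\mathcal V|\le|\mathcal X|+3$, $x:\mathcal U\times\mathcal S\to\mathcal X$ is deterministic, such that $Q_S(s)=\sum_{u,v}P_U(u)P_V(v)P_{S|U,V}(s|u,v)$, $P_Z=Q_0$, and $\mathbb I(V;Y|U)>\max\{\mathbb I(V;Z),\ \mathbb I(U,V;Z)-\mathbb I(U;Y)\}$. Let $$\mathcal S=\{R\ge0:\exists P\in\mathcal D \text{ with } R\le \mathbb I(U;Y)-\max\{\mathbb I(U;S),\ \mathbb I(U,V;S)-\mathbb I(V;Y|U)\}\}.$$ Then the covert capacity satisfies $C_{\mathrm{NC\text{-}T}}\ge\max\{x:x\in\mathcal S\}$.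
   Context: Finite alphabets $\mathcal S,\mathcal X,\mathcal Y,\mathcal Z$. The channel has transition pmf $W_{Y,Z|X,S}$: input $X$, state $S$, output $Y$ at the legitimate receiver and output $Z$ at an adversary (warden). The state sequence $S^n$ is i.i.d. with pmf $Q_S$ and independent of the message; neither the legitimate receiver nor the warden knows the state. $x_0\in\mathcal X$ is a fixed innocent symbol, and $Q_0(z)=\sum_{s}Q_S(s)W_{Z|X,S}(z|x_0,s)$, assumed to have full support on $\mathcal Z$. A $(2^{nR},n)$ code consists of a message $M$ uniform on $\{1,\dots,2^{nR}\}$, an encoder and a decoder of the type specified. $P_{Z^n}$ denotes the distribution of the warden's output induced by the code. A rate $R$ is achievable if there is a sequence of $(2^{nR},n)$ codes with $\mathbb P(\hat M\ne M)\to 0$ and $\mathbb D(P_{Z^n}\|Q_0^{\otimes n})\to 0$ as $n\to\infty$; the covert capacity is the supremum of achievable rates. Mutual informations are computed under the indicated joint pmf. *)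

(* Defs.v *)
From HB Require Import structures.
From mathcomp Require Import all_boot all_order all_algebra.
From mathcomp Require Import all_classical all_reals all_analysis.
Set Implicit Arguments. Unset Strict Implicit. Unset Printing Implicit Defensive.
Import Order.TTheory GRing.Theory Num.Theory.
Import numFieldNormedType.Exports.
Local Open Scope classical_set_scope.
Local Open Scope ring_scope.

Section Info.
Variable R : realType.

Definition log2 (x : R) : R := ln x / ln 2.

Definition pmass (T : finType) (p : T -> R) (E : pred T) : R := \sum_(t | E t) p t.

(* conditional mutual information I(f;g|h) (in bits) of random variables
   f, g, h defined on the finite sample space T with pmf p; terms with
   p t = 0 contribute 0 (convention 0 log 0 = 0). *)
Definition condMI (T A B C : finType) (p : T -> R)
  (f : T -> A) (g : T -> B) (h : T -> C) : R :=
  \sum_(t : T) p t * log2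
    (pmass p (fun t' => [&& f t' == f t, g t' == g t & h t' == h t])
     * pmass p (fun t' => h t' == h t)
     / (pmass p (fun t' => (f t' == f t) && (h t' == h t))
        * pmass p (fun t' => (g t' == g t) && (h t' == h t)))).

Definition MI (T A B : finType) (p : T -> R) (f : T -> A) (g : T -> B) : R :=
  condMI p f g (fun _ => tt).

Definition KL (T : finType) (P Q : T -> R) : R :=
  \sum_(t : T) (if P t == 0 then 0 else P t * log2 (P t / Q t)).

Definition is_pmf (T : finType) (p : T -> R) : Prop :=
  (forall t, 0 <= p t) /\ \sum_(t : T) p t = 1.

End Info.

Section Covert.
Variables (R : realType) (S X Y Z : finType).
(* channel W_{Y,Z|X,S} : W x s y z = W(y,z|x,s) *)
Variable W : X -> S -> Y -> Z -> R.
Variable QS : S -> R.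
Variable x0 : X.

Definition is_channel : Prop :=
  (forall x s y z, 0 <= W x s y z) /\
  (forall x s, \sum_(y : Y) \sum_(z : Z) W x s y z = 1).

Definition Q0 (z : Z) : R := \sum_(s : S) QS s * \sum_(y : Y) W x0 s y z.

Definition QSn n (s : {ffun 'I_n -> S}) : R := \prod_(i < n) QS (s i).
Definition Q0n n (z : {ffun 'I_n -> Z}) : R := \prod_(i < n) Q0 (z i).
Definition Wn n (x : {ffun 'I_n -> X}) (s : {ffun 'I_n -> S})
    (y : {ffun 'I_n -> Y}) (z : {ffun 'I_n -> Z}) : R :=
  \prod_(i < n) W (x i) (s i) (y i) (z i).

Definition nmsg (n : nat) (r : R) : nat := Num.truncn (2 `^ (n%:R * r)).

(* A code with non-causal state information at the transmitter only:
   encoder f : (M, S^n) -> X^n, decoder g : Y^n -> M, M uniform on 'I_K. *)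
Definition err_prob n K (f : 'I_K -> {ffun 'I_n -> S} -> {ffun 'I_n -> X})
    (g : {ffun 'I_n -> Y} -> 'I_K) : R :=
  K%:R^-1 * \sum_(m : 'I_K) \sum_(s : {ffun 'I_n -> S}) QSn s *
    \sum_(y : {ffun 'I_n -> Y}) \sum_(z : {ffun 'I_n -> Z})
      (if g y != m then Wn (f m s) s y z else 0).

Definition PZn n K (f : 'I_K -> {ffun 'I_n -> S} -> {ffun 'I_n -> X})
    (z : {ffun 'I_n -> Z}) : R :=
  K%:R^-1 * \sum_(m : 'I_K) \sum_(s : {ffun 'I_n -> S}) QSn s *
    \sum_(y : {ffun 'I_n -> Y}) Wn (f m s) s y z.

Definition achievable (r : R) : Prop :=
  0 <= r /\
  exists (f : forall n, 'I_(nmsg n r) -> {ffun 'I_n -> S} -> {ffun 'I_n -> X})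
         (g : forall n, {ffun 'I_n -> Y} -> 'I_(nmsg n r)),
    (err_prob (f n) (g n) @[n --> \oo] --> 0) /\
    (KL (@PZn n _ (f n)) (@Q0n n) @[n --> \oo] --> 0).

Definition covert_capacity : \bar R :=
  ereal_sup [set r%:E | r in achievable].

Definition jointP nu nv (PU : 'I_nu -> R) (PV : 'I_nv -> R)
    (PSUV : 'I_nu -> 'I_nv -> S -> R) (xf : 'I_nu -> S -> X)
    (t : 'I_nu * 'I_nv * S * X * Y * Z) : R :=
  let: (u, v, s, x, y, z) := t in
  PU u * PV v * PSUV u v s * (if x == xf u s then 1 else 0) * W x s y z.

Section RV.
Variables nu nv : nat.
Definition rvU (t : 'I_nu * 'I_nv * S * X * Y * Z) := t.1.1.1.1.1.
Definition rvV (t : 'I_nu * 'I_nv * S * X * Y * Z) := t.1.1.1.1.2.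
Definition rvUV (t : 'I_nu * 'I_nv * S * X * Y * Z) := (t.1.1.1.1.1, t.1.1.1.1.2).
Definition rvS (t : 'I_nu * 'I_nv * S * X * Y * Z) := t.1.1.1.2.
Definition rvY (t : 'I_nu * 'I_nv * S * X * Y * Z) := t.1.2.
Definition rvZ (t : 'I_nu * 'I_nv * S * X * Y * Z) := t.2.
End RV.

Definition in_D nu nv (PU : 'I_nu -> R) (PV : 'I_nv -> R)
    (PSUV : 'I_nu -> 'I_nv -> S -> R) (xf : 'I_nu -> S -> X) : Prop :=
  let P := jointP PU PV PSUV xf in
  (nu <= #|X| + 5)%N /\ (nv <= #|X| + 3)%N /\
      is_pmf PU /\ is_pmf PV /\
      (forall u v, is_pmf (PSUV u v)) /\
      (forall s, QS s = \sum_(u : 'I_nu) \sum_(v : 'I_nv) PU u * PV v * PSUV u v s) /\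
      (forall z, pmass P (fun t => @rvZ nu nv t == z) = Q0 z) /\
      condMI P (@rvV nu nv) (@rvY nu nv) (@rvU nu nv) >
        Num.max (MI P (@rvV nu nv) (@rvZ nu nv))
                (MI P (@rvUV nu nv) (@rvZ nu nv) - MI P (@rvU nu nv) (@rvY nu nv)).

Definition rate_set (r : R) : Prop :=
  0 <= r /\
  exists nu nv (PU : 'I_nu -> R) (PV : 'I_nv -> R)
         (PSUV : 'I_nu -> 'I_nv -> S -> R) (xf : 'I_nu -> S -> X),
    in_D PU PV PSUV xf /\
    let P := jointP PU PV PSUV xf in
    r <= MI P (@rvU nu nv) (@rvY nu nv)
         - Num.max (MI P (@rvU nu nv) (@rvS nu nv))
                   (MI P (@rvUV nu nv) (@rvS nu nv)
                    - condMI P (@rvV nu nv) (@rvY nu nv) (@rvU nu nv)).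

End Covert.

(* Main.v *)
Require Import Defs.
From mathcomp Require Import all_boot all_order all_algebra.
From mathcomp Require Import all_classical all_reals all_analysis.
From mathcomp Require Import ring lra.
Set Implicit Arguments. Unset Strict Implicit. Unset Printing Implicit Defensive.
Import Order.TTheory GRing.Theory Num.Theory.
Import numFieldNormedType.Exports.
Local Open Scope ring_scope.

(** The pair T = (U, V) can be used as a single auxiliary variable: by the chain
    rule I(U;Y) + I(V;Y|U) = I(T;Y), so membership in the rate set gives
    I(T;Z) < I(T;Y) and r <= I(T;Y) - I(T;S), and no key has to be carried from
    block to block.  Every rate r' with
    max(0, I(T;Z) - I(T;S)) < r' < I(T;Y) - I(T;S) is achieved as follows.  Draw
    2^(n(r' + rho)) i.i.d. codewords t(m,j), with I(T;S) < rho < I(T;Y) - r'.  If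
    (m,j) were uniform and the state were produced from t(m,j) through P_{S|T}, then
    the state would look i.i.d. given m (rho > I(T;S)), the warden's output would look
    i.i.d. Q0 (r' + rho > I(T;Z)) and m would be decodable (r' + rho < I(T;Y)).
    The likelihood encoder, which draws j from the posterior given (m, s), imitates
    this ideal system.  Encoders being deterministic, j is drawn once and for all
    for each (m, s); averaging over (m, s) suffices to keep the warden's output
    close to Q0^n because r' > I(T;Z) - I(T;S).  All three approximations are
    instances of one covering lemma for sums of independent terms, and all error
    terms decay exponentially, which turns total variation into divergence. *)

(** * Product measures and covering *)

Section ProductMeasure.
Variables (R : realType) (I Om : finType) (p : I -> Om -> R).
Hypothesis p_pmf : forall i, is_pmf (p i).

Definition pprod (w : {ffun I -> Om}) : R := \prod_i p i (w i).

Lemma sum_ffun_prod (h : I -> Om -> R) :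
  \sum_(w : {ffun I -> Om}) \prod_i h i (w i) = \prod_i \sum_o h i o.
Proof. by rewrite bigA_distr_bigA. Qed.

Lemma pprod_ge0 w : 0 <= pprod w.
Proof. by apply: prodr_ge0 => i _; case: (p_pmf i). Qed.

Lemma pprod_sum1 : \sum_w pprod w = 1.
Proof.
rewrite sum_ffun_prod big1 // => i _; by case: (p_pmf i).
Qed.

Lemma pprod_marginal i (F : Om -> R) :
  \sum_w pprod w * F (w i) = \sum_o p i o * F o.
Proof.
pose h k o := p k o * (if k == i then F o else 1).
rewrite (eq_bigr (fun w : {ffun I -> Om} => \prod_k h k (w k))); last first.
  by move=> w _; rewrite big_split /= -big_mkcond big_pred1_eq.
rewrite sum_ffun_prod (bigD1 i) //= [X in _ * X]big1 ?mulr1.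
  by apply: eq_bigr => o _; rewrite /h eqxx.
move=> k /negbTE ki; rewrite -(p_pmf k).2; apply: eq_bigr => o _.
by rewrite /h ki mulr1.
Qed.

Lemma pprod_marginal2 i j (F G : Om -> R) : i != j ->
  \sum_w pprod w * (F (w i) * G (w j)) =
  (\sum_o p i o * F o) * (\sum_o p j o * G o).
Proof.
move=> ij.
pose h k o := p k o * (if k == i then F o else 1) * (if k == j then G o else 1).
rewrite (eq_bigr (fun w : {ffun I -> Om} => \prod_k h k (w k))); last first.
  move=> w _; rewrite !big_split /= -!big_mkcond !big_pred1_eq mulrA //.
rewrite sum_ffun_prod (bigD1 i) //= (bigD1 j) 1?eq_sym //= mulrA.
rewrite [X in _ * X]big1 ?mulr1.
  congr (_ * _); apply: eq_bigr => o _; rewrite /h eqxx.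
    by rewrite (negbTE ij) mulr1.
  by rewrite eq_sym (negbTE ij) mulr1.
move=> k /andP[/negbTE ki /negbTE kj]; rewrite -(p_pmf k).2.
by apply: eq_bigr => o _; rewrite /h ki kj !mulr1.
Qed.

(** Coordinates are independent, so the cross terms vanish after centring, and each variance is at
    most the second moment. *)
Lemma pprod_variance_le (a : I -> Om -> R) :
  \sum_w pprod w * (\sum_i a i (w i) - \sum_i \sum_o p i o * a i o) ^+ 2 <=
  \sum_i \sum_o p i o * a i o ^+ 2.
Proof.
pose e i := \sum_o p i o * a i o.
pose c i o := a i o - e i.
have Ec i : \sum_o p i o * c i o = 0.
  rewrite /c; under eq_bigr do rewrite mulrBr.
  by rewrite sumrB -mulr_suml (p_pmf i).2 mul1r subrr.
have -> : \sum_w pprod w * (\sum_i a i (w i) - \sum_i \sum_o p i o * a i o) ^+ 2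
   = \sum_i \sum_j \sum_w pprod w * (c i (w i) * c j (w j)).
  under [RHS]eq_bigr do rewrite exchange_big.
  rewrite [RHS]exchange_big; apply: eq_bigr => w _ /=.
  rewrite -sumrB expr2 mulr_suml mulr_sumr; apply: eq_bigr => i _.
  by rewrite mulr_sumr mulr_sumr.
apply: ler_sum => i _; rewrite (bigD1 i) //= [X in _ + X]big1 ?addr0; last first.
  by move=> j ji; rewrite pprod_marginal2 1?eq_sym // Ec mul0r.
rewrite (pprod_marginal i (fun o => c i o * c i o)).
have -> : \sum_o p i o * (c i o * c i o) =
   \sum_o p i o * a i o ^+ 2 - e i ^+ 2.
  rewrite (eq_bigr (fun o => p i o * a i o ^+ 2 - (2 * e i) * (p i o * a i o) +
      p i o * e i ^+ 2)); last by move=> o _; rewrite /c; ring.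
  rewrite big_split sumrB /= -mulr_sumr -mulr_suml (p_pmf i).2 -/(e i); ring.
by rewrite lerBlDr lerDl sqr_ge0.
Qed.

End ProductMeasure.

(** Selects a good realization in random coding: if every [F t] exceeded [c], the nonnegative terms
    [p t * (F t - c)] would all vanish, forcing [p = 0]. *)
Lemma exists_le_mean (R : realType) (T : finType) (p F : T -> R) (c : R) :
  is_pmf p -> \sum_t p t * F t <= c -> exists t, F t <= c.
Proof.
move=> [p0 p1] Fc; apply: contrapT => /forallNP nF.
have lt t : c < F t by rewrite ltNge; apply/negP/nF.
have : \sum_t p t * (F t - c) <= 0.
  under eq_bigr do rewrite mulrBr.
  by rewrite sumrB -mulr_suml p1 mul1r subr_le0.
have q0 t : 0 <= p t * (F t - c).
  by apply: mulr_ge0 (p0 t) _; rewrite subr_ge0; apply: ltW.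
rewrite le_eqVlt ltNge sumr_ge0 ?orbF // => /eqP /psumr_eq0P z.
have : \sum_t p t = 0.
  apply: big1 => t _; have /eqP := z (fun t _ => q0 t) t isT.
  by rewrite mulf_eq0 subr_eq0 (gt_eqF (lt t)) orbF => /eqP.
by rewrite p1 => /eqP; rewrite oner_eq0.
Qed.

(* Truncating each summand at [eta * Q b] makes the variance of the sum small;
   the untruncated excess is controlled in L1. *)
Lemma soft_cover (R : realType) (I Om B : finType) (p : I -> Om -> R)
    (F : I -> Om -> B -> R) (Q : B -> R) (eta : R) :
  (forall i, is_pmf (p i)) -> (forall i o b, 0 <= F i o b) ->
  (forall b, 0 <= Q b) -> \sum_b Q b <= 1 -> 0 < eta ->
  \sum_i \sum_o p i o * \sum_b F i o b <= 1 ->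
  \sum_w pprod p w *
      \sum_b `|\sum_i F i (w i) b - \sum_i \sum_o p i o * F i o b| <=
  2 * (\sum_i \sum_o p i o *
        \sum_b (if eta * Q b < F i o b then F i o b else 0)) + Num.sqrt eta.
Proof.
move=> pp F0 Q0 Q1 eta0 F1.
pose G i o b := if eta * Q b < F i o b then 0 else F i o b.
pose H i o b := if eta * Q b < F i o b then F i o b else 0.
have FGH i o b : F i o b = G i o b + H i o b.
  by rewrite /G /H; case: ifP; rewrite ?addr0 ?add0r.
have G0 i o b : 0 <= G i o b by rewrite /G; case: ifP.
have H0 i o b : 0 <= H i o b by rewrite /H; case: ifP.
have GQ i o b : G i o b <= eta * Q b.
  by rewrite /G; case: ltP => // _; rewrite mulr_ge0 // ltW.
have pi0 i o : 0 <= p i o by case: (pp i).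
pose lam := Num.sqrt eta.
have lam0 : 0 < lam by rewrite sqrtr_gt0.
have lam2 : lam ^+ 2 = eta by rewrite sqr_sqrtr // ltW.
pose X w b := \sum_i G i (w i) b - \sum_i \sum_o p i o * G i o b.
(* Cauchy-Schwarz in linear form: [|x| <= lam * Q b / 2 + x ^+ 2 / (2 * (lam * Q b))], while
   truncation bounds the variance at [b] by [eta * Q b] times the mean of [G]. Since
   [lam ^+ 2 = eta], both halves carry a factor [lam] and the sum over [b] is at most [lam]. *)
have XE b : \sum_(w : {ffun I -> Om}) pprod p w * `|X w b| <=
    (lam * Q b + lam * (\sum_i \sum_o p i o * G i o b)) / 2.
  (* Where [Q b] vanishes the truncation level is zero, so [G] vanishes too and no division takes
     place. *)
  have [Qb0|Qb0] := eqVneq (Q b) 0.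
    have Gb0 i o : G i o b = 0.
      by apply/eqP; rewrite eq_le G0 andbT (le_trans (GQ i o b)) // Qb0 mulr0.
    rewrite big1; last first.
      move=> w _; rewrite /X !big1 ?subrr ?normr0 ?mulr0 //.
      by move=> i _; rewrite big1 // => o _; rewrite Gb0 mulr0.
    by rewrite divr_ge0 // addr_ge0 ?mulr_ge0 ?(ltW lam0) // sumr_ge0 // => i _;
      rewrite sumr_ge0 // => o _; rewrite mulr_ge0.
  have Qp : 0 < Q b by rewrite lt_neqAle eq_sym Qb0 Q0.
  have lQ : 0 < lam * Q b by rewrite mulr_gt0.
  have am x : `|x| <= lam * Q b / 2 + (2 * (lam * Q b))^-1 * x ^+ 2.
    rewrite -(real_normK (num_real x)).
    rewrite -(ler_pM2l (_ : 0 < 2 * (lam * Q b))) ?mulr_gt0 //.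
    rewrite mulrDr mulVKf; last by rewrite mulf_neq0 // gt_eqF.
    rewrite -subr_ge0.
    have -> : 2 * (lam * Q b) * (lam * Q b / 2) + `|x| ^+ 2 -
      2 * (lam * Q b) * `|x| = (lam * Q b - `|x|) ^+ 2 by field.
    exact: sqr_ge0.
  apply: (@le_trans _ _ (\sum_(w : {ffun I -> Om}) pprod p w *
     (lam * Q b / 2 + (2 * (lam * Q b))^-1 * X w b ^+ 2))).
    by apply: ler_sum => w _; rewrite ler_wpM2l ?pprod_ge0.
  under eq_bigr do rewrite mulrDr [X in _ + X]mulrCA.
  rewrite big_split /= -mulr_suml pprod_sum1 // mul1r -mulr_sumr.
  rewrite [leRHS]mulrDl lerD2l.
  rewrite -(ler_pM2l (_ : 0 < 2 * (lam * Q b))) ?mulr_gt0 //.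
  rewrite mulVKf; last by rewrite mulf_neq0 // gt_eqF.
  apply: (le_trans (pprod_variance_le pp (fun i o => G i o b))).
  have -> : 2 * (lam * Q b) * (lam * (\sum_i \sum_o p i o * G i o b) / 2) =
     \sum_i \sum_o p i o * (eta * Q b * G i o b).
    under [RHS]eq_bigr do under eq_bigr do rewrite mulrCA.
    under [RHS]eq_bigr do rewrite -mulr_sumr.
    by rewrite -mulr_sumr -lam2; field.
  apply: ler_sum => i _; apply: ler_sum => o _.
  by rewrite ler_wpM2l // expr2 ler_wpM2r.
(* The excess [H] is paid for twice: once in the sampled sum, once in its mean. *)
pose bad := \sum_i \sum_o p i o * \sum_b H i o b.
apply: (@le_trans _ _ (\sum_(w : {ffun I -> Om}) pprod p w *
    (\sum_b `|X w b| + \sum_i \sum_b H i (w i) b + bad))).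
  apply: ler_sum => w _; rewrite ler_wpM2l ?pprod_ge0 //.
  have -> : bad = \sum_b \sum_i \sum_o p i o * H i o b.
    rewrite exchange_big; apply: eq_bigr => i _.
    by rewrite exchange_big; apply: eq_bigr => o _; rewrite mulr_sumr.
  rewrite [X in _ + X + _]exchange_big /= -!big_split /=.
  apply: ler_sum => b _.
  have -> : \sum_i F i (w i) b - \sum_i \sum_o p i o * F i o b =
     X w b + \sum_i H i (w i) b - \sum_i \sum_o p i o * H i o b.
    have -> : \sum_i F i (w i) b = \sum_i G i (w i) b + \sum_i H i (w i) b.
      by rewrite -big_split; apply: eq_bigr => i _.
    have -> : \sum_i \sum_o p i o * F i o b =
       \sum_i \sum_o p i o * G i o b + \sum_i \sum_o p i o * H i o b.
      rewrite -big_split; apply: eq_bigr => i _ /=.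
      by rewrite -big_split; apply: eq_bigr => o _; rewrite FGH mulrDr.
    rewrite /X; ring.
  apply: (le_trans (ler_normB _ _)); apply: lerD; last first.
    rewrite ger0_norm // sumr_ge0 // => i _.
    by rewrite sumr_ge0 // => o _; rewrite mulr_ge0.
  apply: (le_trans (ler_normD _ _)); rewrite lerD2l.
  by rewrite ger0_norm // sumr_ge0.
under eq_bigr do rewrite !mulrDr.
rewrite !big_split /= -mulr_suml pprod_sum1 // mul1r.
have -> : \sum_(w : {ffun I -> Om}) pprod p w * \sum_i \sum_b H i (w i) b = bad.
  under eq_bigr do rewrite mulr_sumr.
  rewrite exchange_big; apply: eq_bigr => i _ /=.
  by rewrite (pprod_marginal pp i (fun o => \sum_b H i o b)).
rewrite -/(H) -/bad mulr2n mulrDl mul1r -addrA addrC lerD2l.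
under eq_bigr do rewrite mulr_sumr.
rewrite exchange_big /=.
apply: (le_trans (ler_sum _ (fun b _ => XE b))).
rewrite -mulr_suml big_split /= -!mulr_sumr -mulrDr -/lam.
rewrite -[leRHS]mulr1 -mulrA ler_pM2l // ler_pdivrMr // mul1r.
rewrite (_ : 2 = 1 + 1 :> R) //; apply: (lerD Q1).
apply: le_trans F1; rewrite exchange_big; apply: ler_sum => i _ /=.
rewrite exchange_big; apply: ler_sum => o _ /=.
rewrite -mulr_sumr ler_wpM2l // ler_sum // => b _.
by rewrite FGH lerDl.
Qed.

(** * One-shot coding *)

Definition margY (R : realType) (S X Y Z : finType) (W : X -> S -> Y -> Z -> R)
  x s y : R := \sum_z W x s y z.
Definition margZ (R : realType) (S X Y Z : finType) (W : X -> S -> Y -> Z -> R)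
  x s z : R := \sum_y W x s y z.

Section OneShot.
Variables (R : realType) (T S X Y Z : finType) (W : X -> S -> Y -> Z -> R).
Variables (PT : T -> R) (PST : T -> S -> R) (xf : T -> S -> X).

Definition outY t y : R := \sum_s PST t s * margY W (xf t s) s y.
Definition outZ t z : R := \sum_s PST t s * margZ W (xf t s) s z.

Variables (QS : S -> R) (PY : Y -> R) (QZ : Z -> R).
Hypothesis W_channel : is_channel W.
Hypothesis PT_pmf : is_pmf PT.
Hypothesis PST_pmf : forall t, is_pmf (PST t).
Hypothesis QSE : forall s, QS s = \sum_t PT t * PST t s.
Hypothesis PYE : forall y, PY y = \sum_t PT t * outY t y.
Hypothesis QZE : forall z, QZ z = \sum_t PT t * outZ t z.

Let PT0 t : 0 <= PT t. Proof. by case: PT_pmf. Qed.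
Let PST0 t s : 0 <= PST t s. Proof. by case: (PST_pmf t). Qed.
Let W0 x s y z : 0 <= W x s y z. Proof. by case: W_channel. Qed.

Lemma margY_ge0 x s y : 0 <= margY W x s y.
Proof. exact: sumr_ge0. Qed.

Lemma margZ_ge0 x s z : 0 <= margZ W x s z.
Proof. exact: sumr_ge0. Qed.

Lemma margY_sum1 x s : \sum_y margY W x s y = 1.
Proof. by case: W_channel => _; apply. Qed.

Lemma margZ_sum1 x s : \sum_z margZ W x s z = 1.
Proof. by rewrite exchange_big margY_sum1. Qed.

Lemma outY_pmf t : is_pmf (outY t).
Proof.
split=> [y|]; first by apply: sumr_ge0 => s _; rewrite mulr_ge0 ?margY_ge0.
rewrite exchange_big -(PST_pmf t).2; apply: eq_bigr => s _ /=.
by rewrite -mulr_sumr margY_sum1 mulr1.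
Qed.

Lemma outZ_pmf t : is_pmf (outZ t).
Proof.
split=> [z|]; first by apply: sumr_ge0 => s _; rewrite mulr_ge0 ?margZ_ge0.
rewrite exchange_big -(PST_pmf t).2; apply: eq_bigr => s _ /=.
by rewrite -mulr_sumr margZ_sum1 mulr1.
Qed.

Lemma mixture_pmf (B : finType) (V : T -> B -> R) (q : B -> R) :
  (forall t, is_pmf (V t)) -> (forall b, q b = \sum_t PT t * V t b) -> is_pmf q.
Proof.
move=> Vp qE; split=> [b|].
  by rewrite qE sumr_ge0 // => t _; rewrite mulr_ge0 //; case: (Vp t).
under eq_bigr do rewrite qE.
rewrite exchange_big -PT_pmf.2; apply: eq_bigr => t _ /=.
by rewrite -mulr_sumr (Vp t).2 mulr1.
Qed.

Let QS_pmf : is_pmf QS. Proof. exact: mixture_pmf PST_pmf QSE. Qed.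
Let PY_pmf : is_pmf PY. Proof. exact: mixture_pmf outY_pmf PYE. Qed.
Let QZ_pmf : is_pmf QZ. Proof. exact: mixture_pmf outZ_pmf QZE. Qed.

Variables (K J : nat).
Hypotheses (K0 : (0 < K)%N) (J0 : (0 < J)%N).

Notation codebook := {ffun 'I_K * 'I_J -> T}.
Notation pC := (pprod (fun _ : 'I_K * 'I_J => PT)).

Let KR : 0 < K%:R :> R. Proof. by rewrite ltr0n. Qed.
Let JR : 0 < J%:R :> R. Proof. by rewrite ltr0n. Qed.
Let KVR : 0 <= K%:R^-1 :> R. Proof. by rewrite invr_ge0 ltW. Qed.
Let JVR : 0 <= J%:R^-1 :> R. Proof. by rewrite invr_ge0 ltW. Qed.

(* The uniform branch is reached only when no codeword of row [m] can produce [s]. *)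
Definition likelihood (C : codebook) m s (j : 'I_J) : R :=
  let d := \sum_(j' < J) PST (C (m, j')) s in
  if d == 0 then J%:R^-1 else PST (C (m, j)) s / d.

Lemma likelihood_pmf (C : codebook) m s : is_pmf (likelihood C m s).
Proof.
have d0 : 0 <= \sum_(j' < J) PST (C (m, j')) s by apply: sumr_ge0.
split=> [j|]; rewrite /likelihood; case: eqVneq => // d1.
- by rewrite divr_ge0.
- by rewrite sumr_const card_ord -[LHS]mulr_natl mulfV // gt_eqF.
- by rewrite -mulr_suml mulfV.
Qed.

(** Bayes' rule: the ideal state law of row [m] times the posterior is the ideal joint law of
    [(j, s)]. It survives a zero denominator, because every [PST (C (m, j)) s] is then zero. *)
Lemma likelihoodE (C : codebook) m s j :
  J%:R^-1 * (\sum_(j' < J) PST (C (m, j')) s) * likelihood C m s j =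
  J%:R^-1 * PST (C (m, j)) s.
Proof.
rewrite /likelihood; case: eqVneq => [d0|d0].
  rewrite d0 mulr0 mul0r; move/psumr_eq0P: d0 => -> //; first by rewrite mulr0.
by rewrite -mulrA [X in _ * X]mulrC divfK.
Qed.

(** L1 distance, averaged over messages, between the true state law and the state law of the ideal
    system given [m]. *)
Definition state_gap (C : codebook) : R :=
  K%:R^-1 * \sum_m \sum_s `|J%:R^-1 * (\sum_j PST (C (m, j)) s) - QS s|.

(** The actual and the ideal system share the posterior of [j] and the kernel [h]; only the law of
    [s] differs, and substochastic kernels do not enlarge an L1 distance. *)
Lemma change_of_measure_tv (C : codebook) (B : finType) (h : 'I_K -> 'I_J -> S -> B -> R) :
  (forall m j s b, 0 <= h m j s b) ->
  (forall m j s, \sum_b h m j s b <= 1) ->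
  \sum_b `|K%:R^-1 * (\sum_m \sum_s QS s * \sum_j likelihood C m s j * h m j s b)
     - K%:R^-1 * \sum_m \sum_s \sum_j J%:R^-1 * PST (C (m, j)) s * h m j s b|
  <= state_gap C.
Proof.
move=> h0 h1.
pose d m s := J%:R^-1 * (\sum_j PST (C (m, j)) s) - QS s.
have L0 m s j : 0 <= likelihood C m s j by case: (likelihood_pmf C m s).
apply: (@le_trans _ _ (\sum_b K%:R^-1 * \sum_m \sum_s \sum_j
    `|d m s| * likelihood C m s j * h m j s b)).
  apply: ler_sum => b _; rewrite -mulrBr normrM ger0_norm // ler_wpM2l //.
  rewrite -sumrB; apply: (le_trans (ler_norm_sum _ _ _)); apply: ler_sum => m _.
  rewrite -sumrB; apply: (le_trans (ler_norm_sum _ _ _)); apply: ler_sum => s _.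
  rewrite mulr_sumr -sumrB; apply: (le_trans (ler_norm_sum _ _ _)).
  apply: ler_sum => j _; rewrite -likelihoodE.
  rewrite (_ : _ - _ = - (d m s * likelihood C m s j * h m j s b)); last first.
    by rewrite /d; ring.
  by rewrite normrN !normrM (ger0_norm (L0 _ _ _)) (ger0_norm (h0 _ _ _ _)).
rewrite -mulr_sumr /state_gap ler_wpM2l // exchange_big; apply: ler_sum => m _.
rewrite exchange_big; apply: ler_sum => s _ /=.
rewrite exchange_big -/(d m s) -[leRHS]mulr1 -(likelihood_pmf C m s).2 mulr_sumr.
apply: ler_sum => j _ /=; rewrite -mulr_sumr -[leRHS]mulr1 ler_wpM2l //.
by rewrite mulr_ge0.
Qed.

(** The case of a one-point output alphabet: means of [[0,1]]-valued quantities can be evaluated in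
    the ideal system at the price of [state_gap]. *)
Lemma change_of_measure (C : codebook) (h : 'I_K -> 'I_J -> S -> R) :
  (forall m j s, 0 <= h m j s <= 1) ->
  K%:R^-1 * (\sum_m \sum_s QS s * \sum_j likelihood C m s j * h m j s) <=
  K%:R^-1 * (\sum_m \sum_s \sum_j J%:R^-1 * PST (C (m, j)) s * h m j s) +
    state_gap C.
Proof.
move=> h01; rewrite -lerBlDl; apply: (le_trans (ler_norm _)).
have := @change_of_measure_tv C unit (fun m j s _ => h m j s).
rewrite (big_pred1 tt) => [|[]]; last by [].
apply=> [m j s _|m j s]; first by case/andP: (h01 m j s).
by rewrite (big_pred1 tt) => [|[]]; last by []; case/andP: (h01 m j s).
Qed.

Lemma sum_pair_fst (m : 'I_K) (g : 'I_J -> R) :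
  \sum_(i : 'I_K * 'I_J) (if i.1 == m then g i.2 else 0) = \sum_j g j.
Proof.
rewrite -(pair_bigA _ (fun a b => if a == m then g b else 0)) /= (bigD1 m) //=.
rewrite [X in _ + X]big1 ?addr0; first by apply: eq_bigr => j _; rewrite eqxx.
by move=> a /negbTE am; rewrite big1 // => b _; rewrite am.
Qed.

(** Upper tail of the likelihood ratio [V t b / q b] under the joint law. The product form of the
    comparison avoids dividing by a vanishing [q b]. *)
Definition tail_gt (B : finType) (V : T -> B -> R) (q : B -> R) (th : R) : R :=
  \sum_t PT t * \sum_b (if th * q b < V t b then V t b else 0).

(** Given the message, only the [J] independent codewords of one row are available, so soft covering
    is applied row by row; truncating [PST t s / J] at [th / J * QS s] is exactly the ratio test of
    [tail_gt]. *)
Lemma mean_state_gap th : 0 < th ->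
  \sum_C pC C * state_gap C <= 2 * tail_gt PST QS th + Num.sqrt (th / J%:R).
Proof.
move=> th0.
pose c := 2 * tail_gt PST QS th + Num.sqrt (th / J%:R).
rewrite /state_gap.
under eq_bigr do rewrite mulrCA mulr_sumr.
rewrite -mulr_sumr exchange_big /= ler_pdivrMl //.
apply: (@le_trans _ _ (\sum_(m < K) c)); last first.
  by rewrite sumr_const card_ord -[leLHS]mulr_natl.
apply: ler_sum => m _.
(* Zero outside row [m], so that [soft_cover] can run over the index set of the whole codebook. *)
pose F (i : 'I_K * 'I_J) t s : R := if i.1 == m then J%:R^-1 * PST t s else 0.
have eq1 t s : \sum_(i : 'I_K * 'I_J) F i t s = PST t s.
  rewrite (sum_pair_fst m (fun=> J%:R^-1 * PST t s)) sumr_const card_ord.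
  by rewrite -[LHS]mulr_natl mulVKf // gt_eqF.
have mean s : \sum_(i : 'I_K * 'I_J) \sum_t PT t * F i t s = QS s.
  rewrite exchange_big QSE; apply: eq_bigr => t _ /=.
  by rewrite -mulr_sumr eq1.
have F0 i t s : 0 <= F i t s by rewrite /F; case: ifP => // _; rewrite mulr_ge0.
have eta0 : 0 < th / J%:R by rewrite divr_gt0.
have QS1 : \sum_s QS s <= 1 by rewrite QS_pmf.2.
have F1 : \sum_(i : 'I_K * 'I_J) \sum_t PT t * \sum_s F i t s <= 1.
  rewrite exchange_big -PT_pmf.2; apply: ler_sum => t _ /=.
  rewrite -mulr_sumr exchange_big; under eq_bigr do rewrite eq1.
  by rewrite (PST_pmf t).2 mulr1.
have H := soft_cover (fun=> PT_pmf) F0 QS_pmf.1 QS1 eta0 F1.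
apply: le_trans (le_trans _ H) _.
  apply: ler_sum => C _; rewrite ler_wpM2l ?pprod_ge0 //.
  apply: ler_sum => s _.
  rewrite mean /F (eq_bigr (fun i : 'I_K * 'I_J =>
    if i.1 == m then J%:R^-1 * PST (C (m, i.2)) s else 0)); last first.
    by case=> a b _ /=; case: eqP => // ->.
  by rewrite (sum_pair_fst m (fun j => J%:R^-1 * PST (C (m, j)) s)) -mulr_sumr.
rewrite /c lerD2r ler_pM2l // /tail_gt exchange_big; apply: ler_sum => t _ /=.
rewrite -mulr_sumr ler_wpM2l // exchange_big; apply: ler_sum => s _ /=.
have QS0 := QS_pmf.1 s.
apply: (@le_trans _ _ (\sum_(i : 'I_K * 'I_J)
   (if i.1 == m then J%:R^-1 * (if th * QS s < PST t s then PST t s else 0) else 0))).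
  apply: ler_sum => i _; rewrite /F; case: eqP => _; last by rewrite if_same.
  rewrite mulrAC (mulrC _ (PST t s)) ltr_pM2r ?invr_gt0 //.
  by case: ifP; rewrite ?mulr0 // mulrC.
rewrite (sum_pair_fst m (fun=> _)) sumr_const card_ord.
by rewrite -[leLHS]mulr_natl mulVKf // gt_eqF.
Qed.

Definition cover_gap (C : codebook) : R :=
  \sum_z `|(K * J)%:R^-1 * (\sum_i outZ (C i) z) - QZ z|.

Let KJR : 0 < (K * J)%:R :> R. Proof. by rewrite ltr0n muln_gt0 K0. Qed.

Lemma sum_const_pair (x : R) : \sum_(i : 'I_K * 'I_J) (K * J)%:R^-1 * x = x.
Proof.
rewrite sumr_const card_prod !card_ord.
by rewrite -[LHS]mulr_natl mulVKf // gt_eqF.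
Qed.

(** For the warden the message is random as well, so all [K * J] codewords take part in the
    covering. *)
Lemma mean_cover_gap th : 0 < th ->
  \sum_C pC C * cover_gap C <= 2 * tail_gt outZ QZ th + Num.sqrt (th / (K * J)%:R).
Proof.
move=> th0.
pose F (i : 'I_K * 'I_J) t z : R := (K * J)%:R^-1 * outZ t z.
have V0 t z : 0 <= outZ t z by case: (outZ_pmf t).
have F0 i t s : 0 <= F i t s by rewrite mulr_ge0 // invr_ge0 ltW.
have eta0 : 0 < th / (K * J)%:R by rewrite divr_gt0.
have Q1 : \sum_s QZ s <= 1 by rewrite QZ_pmf.2.
have F1 : \sum_(i : 'I_K * 'I_J) \sum_t PT t * \sum_s F i t s <= 1.
  rewrite exchange_big -PT_pmf.2; apply: ler_sum => t _ /=.
  rewrite -mulr_sumr exchange_big; under eq_bigr do rewrite sum_const_pair.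
  by rewrite (outZ_pmf t).2 mulr1.
have H := soft_cover (fun=> PT_pmf) F0 QZ_pmf.1 Q1 eta0 F1.
apply: le_trans (le_trans _ H) _.
  apply: ler_sum => C _; rewrite ler_wpM2l ?pprod_ge0 //.
  apply: ler_sum => z _; rewrite -mulr_sumr.
  have -> // : \sum_(i : 'I_K * 'I_J) \sum_t PT t * F i t z = QZ z.
  rewrite exchange_big QZE.
  by apply: eq_bigr => t _ /=; rewrite -mulr_sumr sum_const_pair.
rewrite lerD2r ler_pM2l // /tail_gt exchange_big; apply: ler_sum => t _ /=.
rewrite -mulr_sumr ler_wpM2l // exchange_big; apply: ler_sum => z _ /=.
apply: (@le_trans _ _ (\sum_(i : 'I_K * 'I_J)
   (K * J)%:R^-1 * (if th * QZ z < outZ t z then outZ t z else 0))).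
  apply: ler_sum => i _; rewrite /F.
  rewrite mulrAC (mulrC _ (outZ t z)) ltr_pM2r ?invr_gt0 //.
  by case: ifP; rewrite ?mulr0 // mulrC.
by rewrite sum_const_pair.
Qed.

(** The table [phi] freezes the index [j] drawn for each message and state, which turns the
    stochastic likelihood encoder into a deterministic one. *)
Definition encode (C : codebook) (phi : {ffun 'I_K * S -> 'I_J}) m s : X :=
  xf (C (m, phi (m, s))) s.

Definition error_rate (f : 'I_K -> S -> X) (g : Y -> 'I_K) : R :=
  K%:R^-1 * \sum_m \sum_s QS s *
    \sum_y \sum_z (if g y != m then W (f m s) s y z else 0).

Definition warden_out (f : 'I_K -> S -> X) z : R :=
  K%:R^-1 * \sum_m \sum_s QS s * \sum_y W (f m s) s y z.

(** Mass truncated by [soft_cover] when [phi] is drawn, evaluated in the ideal system: the pair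
    [(m, s)] contributes [QS s * margZ / K], to be compared with [th / K * QZ z]. *)
Definition bad_mass (C : codebook) th : R :=
  K%:R^-1 * (\sum_m \sum_s \sum_j J%:R^-1 * PST (C (m, j)) s *
    \sum_z (if th * QZ z < QS s * margZ W (xf (C (m, j)) s) s z
            then margZ W (xf (C (m, j)) s) s z else 0)).

Notation pphi C := (pprod (fun ms : 'I_K * S => likelihood C ms.1 ms.2)).

Lemma pphi_marginal (C : codebook) m s (h : 'I_J -> R) :
  \sum_phi pphi C phi * h (phi (m, s)) = \sum_j likelihood C m s j * h j.
Proof.
by rewrite (pprod_marginal (fun ms => likelihood_pmf C ms.1 ms.2) (m, s) h).
Qed.

(** With [C] fixed the entries of [phi] are independent, so [soft_cover] brings the warden's output
    close to its mean over [phi]. One [state_gap] then replaces the likelihood encoder by the ideal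
    system, and [cover_gap] compares the latter with [QZ]. The other two copies of [state_gap] come
    from moving the truncated mass, which has weight 2, to the ideal system. *)
Lemma mean_warden_gap (C : codebook) th : 0 < th ->
  \sum_phi pphi C phi * \sum_z `|warden_out (encode C phi) z - QZ z| <=
  2 * bad_mass C th + Num.sqrt (th / K%:R) + 3 * state_gap C + cover_gap C.
Proof.
move=> th0.
have pp i : is_pmf (likelihood C i.1 i.2) := likelihood_pmf C i.1 i.2.
have L0 m s j : 0 <= likelihood C m s j by case: (likelihood_pmf C m s).
have QS0 := QS_pmf.1.
pose w m j s z := margZ W (xf (C (m, j)) s) s z.
have w0 m j s z : 0 <= w m j s z by exact: margZ_ge0.
have w1 m j s : \sum_z w m j s z = 1 by exact: margZ_sum1.
pose F (i : 'I_K * S) j z := K%:R^-1 * (QS i.2 * w i.1 j i.2 z).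
have F0 i t s : 0 <= F i t s by rewrite /F !mulr_ge0.
have eta0 : 0 < th / K%:R by rewrite divr_gt0.
have Q1 : \sum_s QZ s <= 1 by rewrite QZ_pmf.2.
have F1 : \sum_(i : 'I_K * S) \sum_j likelihood C i.1 i.2 j * \sum_z F i j z <= 1.
  rewrite (eq_bigr (fun i : 'I_K * S => K%:R^-1 * QS i.2)); last first.
    move=> i _; under eq_bigr do rewrite -!mulr_sumr w1 mulr1.
    by rewrite -mulr_suml (pp i).2 mul1r.
  rewrite -(pair_bigA _ (fun _ s => K%:R^-1 * QS s)) /=.
  under eq_bigr do rewrite -mulr_sumr QS_pmf.2 mulr1.
  by rewrite sumr_const card_ord -[leLHS]mulr_natl mulfV // gt_eqF.
have H := soft_cover pp F0 QZ_pmf.1 Q1 eta0 F1.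
(* [pbar] is the warden's output law averaged over [phi]; [pid] is its law in the ideal system. *)
pose pbar z := K%:R^-1 *
  (\sum_m \sum_s QS s * \sum_j likelihood C m s j * w m j s z).
pose pid z := K%:R^-1 *
  (\sum_m \sum_s \sum_j J%:R^-1 * PST (C (m, j)) s * w m j s z).
have pbarE z : \sum_(i : 'I_K * S) \sum_j likelihood C i.1 i.2 j * F i j z = pbar z.
  rewrite -(pair_bigA _ (fun m s => \sum_j likelihood C m s j * F (m, s) j z)) /=.
  rewrite /pbar mulr_sumr; apply: eq_bigr => m _.
  rewrite mulr_sumr; apply: eq_bigr => s _.
  rewrite mulrA mulr_sumr; apply: eq_bigr => j _; rewrite /F /=; ring.
have pidE z : pid z = (K * J)%:R^-1 * (\sum_i outZ (C i) z).
  rewrite natrM invfM /pid -mulrA; congr (_ * _).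
  have -> : \sum_i outZ (C i) z = \sum_m \sum_j outZ (C (m, j)) z.
    by rewrite [RHS]pair_bigA; apply: eq_bigr => -[].
  rewrite mulr_sumr.
  apply: eq_bigr => m _; rewrite exchange_big mulr_sumr; apply: eq_bigr => j _ /=.
  by rewrite /outZ mulr_sumr; apply: eq_bigr => s _; rewrite mulrA.
have gap1 : \sum_z `|pbar z - pid z| <= state_gap C.
  by apply: change_of_measure_tv => // m j s; rewrite w1.
have gap2 : \sum_z `|pid z - QZ z| = cover_gap C.
  by apply: eq_bigr => z _; rewrite pidE.
have bad : \sum_(i : 'I_K * S) \sum_j likelihood C i.1 i.2 j *
      \sum_z (if th / K%:R * QZ z < F i j z then F i j z else 0) <=
    bad_mass C th + state_gap C.
  pose h m j s := \sum_z (if th * QZ z < QS s * w m j s z then w m j s z else 0).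
  have h01 m j s : 0 <= h m j s <= 1.
    rewrite sumr_ge0 => [|z _]; last by case: ifP.
    by rewrite -(w1 m j s) ler_sum // => z _; case: ifP.
  have := change_of_measure C h01; rewrite -/(bad_mass C th) => /(le_trans _); apply.
  rewrite -(pair_bigA _ (fun m s => \sum_j likelihood C m s j *
      \sum_z (if th / K%:R * QZ z < F (m, s) j z then F (m, s) j z else 0))) /=.
  rewrite mulr_sumr; apply: ler_sum => m _.
  rewrite mulr_sumr; apply: ler_sum => s _.
  rewrite mulrA mulr_sumr; apply: ler_sum => j _.
  rewrite mulrCA ler_wpM2l // /h mulr_sumr; apply: ler_sum => z _.
  rewrite /F /= mulrAC (mulrC K%:R^-1) ltr_pM2r ?invr_gt0 //.
  by case: ifP; rewrite ?mulr0 // => _; rewrite mulrC mulrA.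
apply: (@le_trans _ _ (\sum_phi pphi C phi *
   (\sum_z `|\sum_i F i (phi i) z - \sum_(i : 'I_K * S) \sum_j likelihood C i.1 i.2 j * F i j z|
    + (state_gap C + cover_gap C)))).
  apply: ler_sum => phi _; rewrite ler_wpM2l ?pprod_ge0 //.
  rewrite -gap2; apply: le_trans (lerD (lexx _) (lerD gap1 (lexx _))).
  rewrite -!big_split; apply: ler_sum => z _ /=; rewrite pbarE.
  rewrite (_ : warden_out _ _ = \sum_i F i (phi i) z).
    apply: le_trans (lerD (lexx _) (ler_normD _ _)).
    apply: le_trans (ler_normD _ _); rewrite le_eqVlt; apply/orP; left.
    by apply/eqP; congr `|_|; ring.
  have -> : \sum_i F i (phi i) z = \sum_m \sum_s F (m, s) (phi (m, s)) z.
    by rewrite [RHS]pair_bigA; apply: eq_bigr => -[].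
  rewrite /warden_out mulr_sumr; apply: eq_bigr => m _.
  by rewrite mulr_sumr; apply: eq_bigr => s _.
under eq_bigr do rewrite mulrDr.
rewrite big_split /= -mulr_suml pprod_sum1 // mul1r.
move: H bad; lra.
Qed.

Definition tail_lt (B : finType) (V : T -> B -> R) (q : B -> R) (th : R) : R :=
  \sum_t PT t * \sum_b (if V t b < th * q b then V t b else 0).

(** The default message is returned only when no codeword passes the test, hence when the sent one
    has failed it. *)
Definition threshold_decoder th (C : codebook) y : 'I_K :=
  odflt (Ordinal K0) [pick m | [exists j, th * PY y <= outY (C (m, j)) y]].

Definition ideal_error th (C : codebook) : R :=
  (K * J)%:R^-1 * \sum_(i : 'I_K * 'I_J) \sum_y
    (if threshold_decoder th C y != i.1 then outY (C i) y else 0).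

(** Union bound: either the sent codeword fails the test or a codeword of another message passes it.
    The latter is independent of the output, whose law is then [PY], so it passes with probability
    at most [1 / th] by Markov's inequality for the likelihood ratio. Other codewords of the sent
    message do no harm. *)
Lemma mean_ideal_error th : 0 < th ->
  \sum_C pC C * ideal_error th C <= tail_lt outY PY th + (K * J)%:R / th.
Proof.
move=> th0.
have V0 t y : 0 <= outY t y by case: (outY_pmf t).
pose A t y := th * PY y <= outY t y.
have miss (C : codebook) i y :
    (if threshold_decoder th C y != i.1 then outY (C i) y else 0) <=
    (if outY (C i) y < th * PY y then outY (C i) y else 0) +
    \sum_(i' | i'.1 != i.1) outY (C i) y * (A (C i') y)%:R.
  have s0 : 0 <= \sum_(i' : 'I_K * 'I_J | i'.1 != i.1) outY (C i) y * (A (C i') y)%:R.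
    by apply: sumr_ge0 => i' _; rewrite mulr_ge0.
  case: ifP => [ne|_]; last by rewrite addr_ge0 //; case: ifP.
  case: ltP => [_|Ai]; first by rewrite lerDl.
  rewrite add0r; move: ne; rewrite /threshold_decoder; case: pickP => [m|none] /=.
    move=> /existsP[j Aj] ne; rewrite (bigD1 (m, j)) //= {1}/A Aj mulr1 lerDl.
    by apply: sumr_ge0 => i' _; rewrite mulr_ge0.
  by move: (none i.1) => /existsP[]; exists i.2; case: i Ai {s0}.
have Et i : \sum_C pC C * \sum_y (if outY (C i) y < th * PY y then outY (C i) y else 0)
    = tail_lt outY PY th.
  by rewrite (pprod_marginal (fun=> PT_pmf) i
    (fun t => \sum_y (if outY t y < th * PY y then outY t y else 0))).
have Ec i i' : i'.1 != i.1 ->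
    \sum_C pC C * \sum_y outY (C i) y * (A (C i') y)%:R <= th^-1.
  move=> ii'; have ne : i != i' by apply: contra ii' => /eqP ->.
  under eq_bigr do rewrite mulr_sumr.
  rewrite exchange_big /=.
  under eq_bigr do rewrite (pprod_marginal2 (fun=> PT_pmf)
    (fun t => outY t _) (fun t => (A t _)%:R) ne) -PYE mulr_sumr.
  rewrite -[leRHS]mulr1 -[X in _ <= _ * X]PY_pmf.2 mulr_sumr; apply: ler_sum => y _.
  rewrite [in leRHS]PYE mulr_sumr; apply: ler_sum => t _.
  rewrite mulrCA [leRHS]mulrCA ler_wpM2l // /A.
  case: (boolP (th * PY y <= outY t y)) => [le|_].
    by rewrite /= mulr1 -(ler_pM2l th0) mulVKf // gt_eqF.
  by rewrite mulr0 mulr_ge0 // invr_ge0 ltW.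
rewrite /ideal_error; under eq_bigr do rewrite mulrCA.
rewrite -mulr_sumr ler_pdivrMl //.
apply: (@le_trans _ _ (\sum_(i : 'I_K * 'I_J) (tail_lt outY PY th + (K * J)%:R / th)));
  last by rewrite sumr_const card_prod !card_ord -[leLHS]mulr_natl.
under eq_bigr do rewrite mulr_sumr.
rewrite exchange_big; apply: ler_sum => i _ /=.
apply: (@le_trans _ _ (\sum_C (pC C * (\sum_y
   (if outY (C i) y < th * PY y then outY (C i) y else 0)) +
   \sum_(i' | i'.1 != i.1) pC C * \sum_y outY (C i) y * (A (C i') y)%:R))).
  apply: ler_sum => C _; rewrite -mulr_sumr -mulrDr ler_wpM2l ?pprod_ge0 //.
  rewrite exchange_big -big_split; apply: ler_sum => y _; exact: miss.
rewrite big_split /= Et lerD2l exchange_big /=.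
apply: (@le_trans _ _ (\sum_(i' : 'I_K * 'I_J) th^-1)); last first.
  by rewrite sumr_const card_prod !card_ord mulr_natl.
rewrite [leRHS](bigID (fun i' => i'.1 != i.1)) /=.
apply: (@le_trans _ _ (\sum_(i' : 'I_K * 'I_J | i'.1 != i.1) th^-1)).
  by apply: ler_sum => i' ii'; exact: Ec.
by rewrite lerDl sumr_ge0 // => *; rewrite invr_ge0 ltW.
Qed.

(** Averaging over [phi] restores the likelihood encoder, whose error probability a change of
    measure compares with the ideal one. *)
Lemma mean_error_rate th (C : codebook) :
  \sum_phi pphi C phi * error_rate (encode C phi) (threshold_decoder th C) <=
  ideal_error th C + state_gap C.
Proof.
pose g := threshold_decoder th C.
pose h m j s := \sum_y \sum_z (if g y != m then W (xf (C (m, j)) s) s y z else 0).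
have h01 m j s : 0 <= h m j s <= 1.
  rewrite sumr_ge0 => [|y _]; last by rewrite sumr_ge0 // => z _; case: ifP.
  rewrite -(W_channel.2 (xf (C (m, j)) s) s).
  by apply: ler_sum => y _; apply: ler_sum => z _; case: ifP.
have <- : K%:R^-1 * (\sum_m \sum_s QS s * \sum_j likelihood C m s j * h m j s) =
    \sum_phi pphi C phi * error_rate (encode C phi) g.
  rewrite /error_rate; under [RHS]eq_bigr do rewrite mulrCA mulr_sumr.
  rewrite -[RHS]mulr_sumr [in RHS]exchange_big; congr (_ * _); apply: eq_bigr => m _ /=.
  under [RHS]eq_bigr do rewrite mulr_sumr.
  rewrite [RHS]exchange_big; apply: eq_bigr => s _ /=.
  under [RHS]eq_bigr do rewrite mulrCA.
  by rewrite -[RHS]mulr_sumr -(pphi_marginal C m s (fun j => h m j s)).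
apply: (le_trans (change_of_measure C h01)); rewrite lerD2r le_eqVlt; apply/orP; left.
apply/eqP; rewrite /ideal_error natrM invfM -[RHS]mulrA; congr (_ * _).
have -> : \sum_(i : 'I_K * 'I_J) \sum_y (if g y != i.1 then outY (C i) y else 0) =
   \sum_m \sum_j \sum_y (if g y != m then outY (C (m, j)) y else 0).
  by rewrite [RHS]pair_bigA; apply: eq_bigr => -[].
rewrite mulr_sumr; apply: eq_bigr => m _.
rewrite exchange_big mulr_sumr; apply: eq_bigr => j _ /=.
rewrite mulr_sumr; under eq_bigr do rewrite -mulrA mulr_sumr mulr_sumr.
rewrite exchange_big; apply: eq_bigr => y _ /=.
rewrite -mulr_sumr; congr (_ * _); case: (g y != m); last first.
  by rewrite big1 // => s _; rewrite big1 ?mulr0.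
by [].
Qed.

Lemma mean_bad_mass th :
  \sum_C pC C * bad_mass C th =
  \sum_t PT t * \sum_s PST t s *
    \sum_z (if th * QZ z < QS s * margZ W (xf t s) s z
            then margZ W (xf t s) s z else 0).
Proof.
pose b t := \sum_s PST t s *
    \sum_z (if th * QZ z < QS s * margZ W (xf t s) s z
            then margZ W (xf t s) s z else 0).
transitivity (\sum_C pC C * \sum_(i : 'I_K * 'I_J) (K * J)%:R^-1 * b (C i)).
  apply: eq_bigr => C _; congr (_ * _); rewrite -mulr_sumr natrM invfM -mulrA.
  congr (_ * _).
  have -> : \sum_(i : 'I_K * 'I_J) b (C i) = \sum_m \sum_j b (C (m, j)).
    by rewrite [RHS]pair_bigA; apply: eq_bigr => -[].
  rewrite mulr_sumr; apply: eq_bigr => m _.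
  rewrite exchange_big mulr_sumr; apply: eq_bigr => j _ /=.
  by rewrite mulr_sumr; apply: eq_bigr => s _; rewrite mulrA.
under eq_bigr do rewrite mulr_sumr.
rewrite exchange_big -[RHS]sum_const_pair; apply: eq_bigr => i _ /=.
under eq_bigr do rewrite mulrCA.
by rewrite -mulr_sumr (pprod_marginal (fun=> PT_pmf) i b).
Qed.

(** Two successive selections, first of the codebook, then of [phi]. Error rate and warden's
    distance are kept in one sum, so a single code is good for both. The factor 4 collects one
    [state_gap] from decoding and three from the warden. *)
Lemma one_shot_code th1 th2 th3 th4 :
  0 < th1 -> 0 < th2 -> 0 < th3 -> 0 < th4 ->
  exists (f : 'I_K -> S -> X) (g : Y -> 'I_K),
    error_rate f g + \sum_z `|warden_out f z - QZ z| <=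
    (tail_lt outY PY th3 + (K * J)%:R / th3) +
    4 * (2 * tail_gt PST QS th2 + Num.sqrt (th2 / J%:R)) +
    (2 * tail_gt outZ QZ th1 + Num.sqrt (th1 / (K * J)%:R)) +
    (2 * (\sum_t PT t * \sum_s PST t s *
      \sum_z (if th4 * QZ z < QS s * margZ W (xf t s) s z
              then margZ W (xf t s) s z else 0)) + Num.sqrt (th4 / K%:R)).
Proof.
move=> h1 h2 h3 h4.
set bound := (X in exists f g, _ <= X).
have pC_pmf : is_pmf pC.
  by split; [exact: pprod_ge0 | exact: pprod_sum1].
pose cost C := ideal_error th3 C + 4 * state_gap C + cover_gap C +
  (2 * bad_mass C th4 + Num.sqrt (th4 / K%:R)).
have [C CB] : exists C, cost C <= bound.
  apply: (exists_le_mean pC_pmf).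
  have -> : \sum_C pC C * cost C = \sum_C pC C * ideal_error th3 C +
     4 * (\sum_C pC C * state_gap C) + \sum_C pC C * cover_gap C +
     (2 * (\sum_C pC C * bad_mass C th4) + Num.sqrt (th4 / K%:R)).
    have s1 : \sum_C pC C * Num.sqrt (th4 / K%:R) = Num.sqrt (th4 / K%:R).
      by rewrite -mulr_suml pC_pmf.2 mul1r.
    rewrite -[X in _ = _ + (_ + X)]s1 !mulr_sumr.
    by rewrite -!big_split; apply: eq_bigr => C _; rewrite /cost /=; ring.
  rewrite mean_bad_mass /bound lerD2r.
  have := mean_ideal_error h3; have := mean_state_gap h2; have := mean_cover_gap h1.
  lra.
have [phi phiB] : exists phi, error_rate (encode C phi) (threshold_decoder th3 C) +
     \sum_z `|warden_out (encode C phi) z - QZ z| <= cost C.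
  apply: (@exists_le_mean _ _ (pphi C)).
    split=> [phi|]; [apply: pprod_ge0|apply: pprod_sum1]; move=> i;
    exact: likelihood_pmf.
  under eq_bigr do rewrite mulrDr.
  rewrite big_split /=.
  have := mean_error_rate th3 C; have := mean_warden_gap C h4; rewrite /cost; lra.
exists (encode C phi), (threshold_decoder th3 C); exact: le_trans phiB CB.
Qed.

End OneShot.

(** * Divergence and large deviations *)

Lemma ln_le_subr1 (R : realType) (x : R) : 0 < x -> ln x <= x - 1.
Proof.
move=> x0; rewrite -[in leLHS](subrK 1 x) addrC; apply: le_ln1Dx.
by rewrite ltrBrDl subrr.
Qed.

Lemma gibbs (R : realType) (T : finType) (P Q : T -> R) :
  is_pmf P -> is_pmf Q -> (forall t, 0 < P t -> 0 < Q t) ->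
  0 <= \sum_t P t * ln (P t / Q t).
Proof.
move=> [P0 P1] [Q0 Q1] PQ.
apply: (@le_trans _ _ (\sum_t (P t - Q t))); first by rewrite sumrB P1 Q1 subrr.
apply: ler_sum => t _; have [Pt0|Pt0] := eqVneq (P t) 0.
  by rewrite Pt0 mul0r sub0r oppr_le0.
have Pt : 0 < P t by rewrite lt_neqAle eq_sym Pt0 P0.
have Qt := PQ _ Pt.
rewrite -[P t / Q t]invrK invf_div lnV ?posrE ?divr_gt0 // mulrN.
rewrite lerNr opprB.
apply: (le_trans (ler_wpM2l (P0 t) (ln_le_subr1 (divr_gt0 Qt Pt)))).
by rewrite mulrBr mulr1 mulrCA mulfV // mulr1.
Qed.

Lemma ln2_gt0 (R : realType) : 0 < ln 2 :> R.
Proof. by rewrite ln_gt0 // ltr1n. Qed.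

Lemma KL_ge0 (R : realType) (T : finType) (P Q : T -> R) :
  is_pmf P -> is_pmf Q -> (forall t, 0 < Q t) -> 0 <= KL P Q.
Proof.
move=> PP QQ Qp.
have -> : KL P Q = (\sum_t P t * ln (P t / Q t)) / ln 2.
  rewrite mulr_suml; apply: eq_bigr => t _.
  by case: eqP => [->|_]; rewrite ?mul0r // /log2 mulrA.
by rewrite divr_ge0 ?(ltW (ln2_gt0 R)) // gibbs.
Qed.

(** Terms with [P t <= Q t] are nonpositive. Otherwise [P ln (P/Q)] splits into [(P - Q) ln (P/Q)],
    where [P/Q <= 1/q], and [Q ln (P/Q)], which is at most [P - Q]. *)
Lemma KL_le_tv (R : realType) (T : finType) (P Q : T -> R) (q : R) :
  is_pmf P -> 0 < q <= 1 -> (forall t, q <= Q t) ->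
  KL P Q <= (1 - ln q) / ln 2 * \sum_t `|P t - Q t|.
Proof.
move=> [P0 P1] /andP[q0 q1] qQ; rewrite mulr_sumr; apply: ler_sum => t _.
have Qt : 0 < Q t by exact: lt_le_trans (qQ t).
have lq : ln q <= 0 by exact: ln_le0.
have ge0 : 0 <= (1 - ln q) / ln 2 * `|P t - Q t|.
  by rewrite mulr_ge0 // divr_ge0 ?(ltW (ln2_gt0 R)) // subr_ge0 (le_trans lq).
case: eqVneq => // Pt0.
have Pt : 0 < P t by rewrite lt_neqAle eq_sym Pt0 P0.
rewrite /log2 [leLHS]mulrA [leRHS]mulrAC ler_pM2r ?invr_gt0 ?ln2_gt0 //.
have [PQ|QP] := leP (P t) (Q t).
  apply: (@le_trans _ _ 0); last by rewrite mulr_ge0 // subr_ge0 (le_trans lq).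
  by rewrite mulr_ge0_le0 // ln_le0 // ler_pdivrMr // mul1r.
rewrite gtr0_norm ?subr_gt0 //.
have r0 : 0 < P t / Q t by rewrite divr_gt0.
have h1 : ln (P t / Q t) <= - ln q.
  rewrite -lnV ?posrE // ler_ln ?posrE ?invr_gt0 // ler_pdivrMr //.
  have Ple1 : P t <= 1.
    by rewrite -P1 (bigD1 t) //= lerDl sumr_ge0.
  apply: (le_trans Ple1); rewrite -(mulVf (lt0r_neq0 q0)).
  by rewrite ler_wpM2l // invr_ge0 ltW.
have h2 := ln_le_subr1 r0.
have -> : P t * ln (P t / Q t) =
    (P t - Q t) * ln (P t / Q t) + Q t * ln (P t / Q t) by ring.
have -> : (1 - ln q) * (P t - Q t) = (P t - Q t) * (- ln q) + (P t - Q t) by ring.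
apply: lerD; first by rewrite ler_wpM2l // subr_ge0 ltW.
apply: (le_trans (ler_wpM2l (ltW Qt) h2)).
by rewrite mulrBr mulr1 mulrC divfK ?gt_eqF.
Qed.

(** Follows from [expR u <= 1 / (1 - u)], since [(1 - u) (1 + u + 2 u^2) = 1 + u^2 (1 - 2 u)]. *)
Lemma expR_le_quadratic (R : realType) (u : R) :
  u <= 2^-1 -> expR u <= 1 + u + 2 * u ^+ 2.
Proof.
move=> u2; have u1 : 0 < 1 - u by lra.
have : expR u <= (1 - u)^-1.
  rewrite -[u in leLHS]opprK expRN lef_pV2 ?posrE ?expR_gt0 //.
  exact: expR_ge1Dx.
move=> /le_trans; apply; rewrite -(ler_pM2l u1) mulfV ?gt_eqF //.
rewrite -subr_ge0.
have -> : (1 - u) * (1 + u + 2 * u ^+ 2) - 1 = u ^+ 2 * (1 - 2 * u) by ring.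
by rewrite mulr_ge0 ?sqr_ge0 //; lra.
Qed.

(** The exponent has negative mean, so the first-order term in [s] beats the quadratic remainder for
    small [s]. *)
Lemma mgf_lt1 (R : realType) (A : finType) (p l : A -> R) (c : R) :
  is_pmf p -> \sum_a p a * l a < c ->
  exists2 s : R, 0 < s & \sum_a p a * expR (s * (l a - c)) < 1.
Proof.
move=> [p0 p1] lc.
pose d := c - \sum_a p a * l a; pose M := 1 + \sum_a `|l a - c|.
have d0 : 0 < d by rewrite subr_gt0.
have nM a : `|l a - c| <= M.
  rewrite /M (bigD1 a) //= addrCA lerDl addr_ge0 // sumr_ge0 //.
have M1 : 1 <= M by rewrite lerDl sumr_ge0.
have M0 : 0 < M by lra.
have dE : \sum_a p a * (l a - c) = - d.
  under eq_bigr do rewrite mulrBr.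
  by rewrite sumrB -mulr_suml p1 mul1r /d opprB.
have dM : d <= M.
  rewrite -[d]opprK -dE; apply: (le_trans (ler_norm _)); rewrite normrN.
  apply: (le_trans (ler_norm_sum _ _ _)).
  rewrite -[M]mul1r -p1 mulr_suml; apply: ler_sum => a _.
  by rewrite normrM (ger0_norm (p0 a)) ler_wpM2l.
(* This choice makes the remainder [2 * (s * M) ^+ 2] equal to [s * d / 2], half of the first-order
   gain; [d <= M] keeps the exponents below [1/2]. *)
pose s := d / (4 * M ^+ 2).
have s0 : 0 < s by rewrite divr_gt0 // mulr_gt0 // exprn_gt0.
have sM : s * (4 * M ^+ 2) = d by rewrite divfK // gt_eqF // mulr_gt0 // exprn_gt0.
have sMd : s * M <= 4^-1.
  rewrite -(ler_pM2r M0) (_ : s * M * M = d / 4); first lra.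
  by rewrite -sM; field.
exists s => //.
apply: (@le_lt_trans _ _ (\sum_a (p a + s * (p a * (l a - c)) + p a * (2 * (s * M) ^+ 2)))).
  apply: ler_sum => a _; set u := l a - c.
  have uM : `|s * u| <= s * M by rewrite normrM gtr0_norm // ler_pM2l //; exact: nM.
  have u2 : s * u <= 2^-1.
    by apply: (le_trans (ler_norm _)); apply: (le_trans uM); lra.
  apply: (le_trans (ler_wpM2l (p0 a) (expR_le_quadratic u2))).
  have -> : p a + s * (p a * u) + p a * (2 * (s * M) ^+ 2) =
     p a * (1 + s * u + 2 * (s * M) ^+ 2) by ring.
  rewrite ler_wpM2l // lerD2l ler_pM2l // -(real_normK (num_real (s * u))).
  by rewrite lerXn2r ?nnegrE // mulr_ge0 // ltW.
rewrite !big_split /= -mulr_sumr dE -mulr_suml p1 mul1r.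
have -> : 2 * (s * M) ^+ 2 = s * d / 2 by rewrite -sM; field.
have : 0 < s * d by rewrite mulr_gt0.
lra.
Qed.

(** Exponential Markov inequality. The growth condition is asked only of words whose letters all
    have positive mass, since the others contribute zero; this lets [l] be a log-ratio. *)
Lemma chernoff_tail (R : realType) (A : finType) (p l : A -> R) (c : R) :
  is_pmf p -> \sum_a p a * l a < c ->
  exists2 g : R, 0 < g < 1 & forall n (E : pred {ffun 'I_n -> A}),
    (forall a, E a -> (forall i, 0 < p (a i)) -> n%:R * c <= \sum_i l (a i)) ->
    \sum_(a : {ffun 'I_n -> A} | E a) \prod_i p (a i) <= g ^+ n.
Proof.
move=> pp lc; have [s s0 mgf] := mgf_lt1 pp lc; have p0 := pp.1.
set m := (X in X < 1) in mgf.
have m0 : 0 <= m by apply: sumr_ge0 => a _; rewrite mulr_ge0 // expR_ge0.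
(* Only [0 <= m < 1] is at hand; the midpoint of [m] and 1 is also positive. *)
exists ((1 + m) / 2); first lra.
move=> n E Ebig.
apply: (@le_trans _ _ (m ^+ n)); last by rewrite lerXn2r ?nnegrE //; lra.
have -> : m ^+ n = \sum_(a : {ffun 'I_n -> A}) \prod_i (p (a i) * expR (s * (l (a i) - c))).
  rewrite (sum_ffun_prod (fun (_ : 'I_n) a => p a * expR (s * (l a - c)))).
  by rewrite prodr_const card_ord.
rewrite [leRHS](bigID E) /=; rewrite -[leLHS]addr0; apply: lerD; last first.
  apply: sumr_ge0 => a _; apply: prodr_ge0 => i _; rewrite mulr_ge0 // expR_ge0.
apply: ler_sum => a Ea; rewrite big_split /=.
have pr0 : 0 <= \prod_i p (a i) by apply: prodr_ge0.
have [/forallP pos|/forallPn[i]] := boolP [forall i, 0 < p (a i)]; last first.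
  rewrite -leNgt => pi; have pi0 : p (a i) = 0 by apply/eqP; rewrite eq_le pi p0.
  by rewrite (bigD1 i) //= pi0 !mul0r.
rewrite -[leLHS]mulr1 ler_wpM2l // -expR_sum -expR0 ler_expR -mulr_sumr.
rewrite mulr_ge0 ?(ltW s0) // sumrB sumr_const card_ord -[c *+ n]mulr_natl.
by rewrite subr_ge0 Ebig.
Qed.

Lemma sum_ffun_pair (R : realType) (I A B : finType)
    (F : {ffun I -> A} -> {ffun I -> B} -> R) :
  \sum_a \sum_b F a b =
  \sum_(w : {ffun I -> A * B}) F [ffun i => (w i).1] [ffun i => (w i).2].
Proof.
rewrite pair_bigA /=.
rewrite (reindex (fun w : {ffun I -> A * B} =>
  ([ffun i => (w i).1], [ffun i => (w i).2]))) //=.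
exists (fun ab : {ffun I -> A} * {ffun I -> B} => [ffun i => (ab.1 i, ab.2 i)]).
  by move=> w _; apply/ffunP => i; rewrite !ffunE; case: (w i).
by move=> [a b] _; congr (_, _); apply/ffunP => i; rewrite !ffunE.
Qed.

(** * Block extensions *)

Definition extn (R : realType) (A B : finType) (V : A -> B -> R) n
  (a : {ffun 'I_n -> A}) (b : {ffun 'I_n -> B}) : R := \prod_i V (a i) (b i).

Lemma QSn_pmf (R : realType) (A : finType) (p : A -> R) n :
  is_pmf p -> is_pmf (@QSn R A p n).
Proof.
move=> pp; split; first exact: (@pprod_ge0 R _ A (fun _ : 'I_n => p)).
by apply: (@pprod_sum1 R _ A (fun _ : 'I_n => p)).
Qed.

Lemma extn_pmf (R : realType) (A B : finType) (V : A -> B -> R) n a :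
  (forall t, is_pmf (V t)) -> is_pmf (@extn R A B V n a).
Proof.
move=> pp; split; first exact: (@pprod_ge0 R _ B (fun i => V (a i))).
by apply: (@pprod_sum1 R _ B (fun i => V (a i))).
Qed.

Lemma extn_mixture (R : realType) (A B : finType) (p : A -> R) (V : A -> B -> R)
    (q : B -> R) n b : (forall b, q b = \sum_a p a * V a b) ->
  @QSn R B q n b = \sum_a QSn p a * extn V a b.
Proof.
move=> qE; rewrite /QSn; under [LHS]eq_bigr do rewrite qE.
rewrite -(sum_ffun_prod (fun i a => p a * V a (b i))).
by apply: eq_bigr => a _; rewrite big_split.
Qed.

Lemma expR_sum_ln_ratio (R : realType) (I : finType) (v q : I -> R) :
  (forall i, 0 < v i) -> (forall i, 0 < q i) ->
  expR (\sum_i ln (v i / q i)) = (\prod_i v i) / \prod_i q i.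
Proof.
move=> v0 q0; rewrite expR_sum -prodf_div; apply: eq_bigr => i _.
by rewrite lnK // posrE divr_gt0.
Qed.

(** * Exponential decay of likelihood-ratio tails *)

Section Tails.
Variables (R : realType) (A B : finType) (p : A -> R) (V : A -> B -> R).
Hypothesis p_pmf : is_pmf p.
Hypothesis V_pmf : forall a, is_pmf (V a).

Lemma pair_tail (l : A -> B -> R) (c : R) :
  \sum_a p a * \sum_b V a b * l a b < c ->
  exists2 g : R, 0 < g < 1 &
  forall n (E : {ffun 'I_n -> A} -> {ffun 'I_n -> B} -> bool),
    (forall a b, E a b -> (forall i, 0 < p (a i)) ->
       (forall i, 0 < V (a i) (b i)) -> n%:R * c <= \sum_i l (a i) (b i)) ->
    \sum_a QSn p a * \sum_b (if E a b then extn V a b else 0) <= g ^+ n.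
Proof.
move=> lc; have p0 := p_pmf.1; have V0 a := (V_pmf a).1.
pose j (ab : A * B) := p ab.1 * V ab.1 ab.2.
have jp : is_pmf j.
  split=> [ab|]; first by rewrite mulr_ge0.
  rewrite -(pair_bigA _ (fun a b => p a * V a b)) /= -p_pmf.2.
  by apply: eq_bigr => a _; rewrite -mulr_sumr (V_pmf a).2 mulr1.
have jl : \sum_ab j ab * l ab.1 ab.2 < c.
  apply: le_lt_trans lc; rewrite -(pair_bigA _ (fun a b => p a * V a b * l a b)) /=.
  by apply: ler_sum => a _; rewrite mulr_sumr; apply: ler_sum => b _; rewrite mulrA.
have [g g01 H] := chernoff_tail jp jl; exists g => // n E Ebig.
under eq_bigr do rewrite mulr_sumr.
rewrite sum_ffun_pair.
have := H n (fun w => E [ffun i => (w i).1] [ffun i => (w i).2]).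
rewrite big_mkcond => le; apply: le_trans (le _).
  apply: ler_sum => w _; case: ifP => _; last by rewrite mulr0.
  rewrite /QSn /extn -big_split; apply: ler_prod => i _ /=; rewrite !ffunE.
  by rewrite /j lexx mulr_ge0.
move=> w Ew jpos.
have := Ebig _ _ Ew; under [X in _ <= X]eq_bigr do rewrite !ffunE; apply=> i;
  rewrite ?ffunE; move: (jpos i); rewrite /j !lt0r mulf_eq0 negb_or.
  by rewrite p0 andbT => /andP[/andP[]].
by rewrite V0 andbT => /andP[/andP[]].
Qed.

Variable q : B -> R.
Hypothesis qE : forall b, q b = \sum_a p a * V a b.

Lemma mixture_gt0 a b : 0 < p a -> 0 < V a b -> 0 < q b.
Proof.
move=> pa Vab; rewrite qE (bigD1 a) //=; apply: ltr_pwDl; first exact: mulr_gt0.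
by apply: sumr_ge0 => a' _; rewrite mulr_ge0 ?(V_pmf _).1 ?p_pmf.1.
Qed.

(** [ln (V a b / q b)] is the information density, whose mean is the mutual information in nats;
    Chernoff's bound applies to its sum over the block. *)
Lemma tail_gt_exponential (c : R) :
  \sum_a p a * \sum_b V a b * ln (V a b / q b) < c ->
  exists2 g : R, 0 < g < 1 &
  forall n, tail_gt (@QSn R A p n) (@extn R A B V n) (@QSn R B q n) (expR (n%:R * c)) <= g ^+ n.
Proof.
move=> lc; have [g g01 H] := pair_tail lc; exists g => // n; apply: H => a b big p0 V0.
have q0 i : 0 < q (b i) by exact: mixture_gt0 (p0 i) (V0 i).
rewrite -ler_expR expR_sum_ln_ratio // ler_pdivlMr ?prodr_gt0 //; exact: ltW.
Qed.

Lemma tail_lt_exponential (c : R) :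
  c < \sum_a p a * \sum_b V a b * ln (V a b / q b) ->
  exists2 g : R, 0 < g < 1 &
  forall n, tail_lt (@QSn R A p n) (@extn R A B V n) (@QSn R B q n) (expR (n%:R * c)) <= g ^+ n.
Proof.
rewrite -ltrN2 => lc.
(* The lower tail is the upper tail of the negated density. *)
have lc' : \sum_a p a * \sum_b V a b * - ln (V a b / q b) < - c.
  apply: le_lt_trans lc; rewrite -sumrN; apply: ler_sum => a _.
  by rewrite -mulrN -sumrN; under eq_bigr do rewrite mulrN.
have [g g01 H] := pair_tail lc'; exists g => // n; apply: H => a b big p0 V0.
have q0 i : 0 < q (b i) by exact: mixture_gt0 (p0 i) (V0 i).
rewrite sumrN mulrN lerN2 -ler_expR expR_sum_ln_ratio // ler_pdivrMr ?prodr_gt0 //.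
exact: ltW.
Qed.

End Tails.

Section Blocks.
Variables (R : realType) (T S X Y Z : finType) (W : X -> S -> Y -> Z -> R).
Variables (PST : T -> S -> R) (xf : T -> S -> X).
Variable n : nat.

Definition xfn (t : {ffun 'I_n -> T}) (s : {ffun 'I_n -> S}) : {ffun 'I_n -> X} :=
  [ffun i => xf (t i) (s i)].

Lemma Wn_channel : is_channel W -> is_channel (@Wn R S X Y Z W n).
Proof.
move=> [W0 W1]; split=> [x s y z|x s]; first exact: prodr_ge0.
under eq_bigr do rewrite /Wn (sum_ffun_prod (fun i z => W (x i) (s i) _ z)).
rewrite (sum_ffun_prod (fun i y => \sum_z W (x i) (s i) y z)).
by apply: big1.
Qed.

Lemma margY_Wn x s y :
  margY (@Wn R S X Y Z W n) x s y = \prod_i margY W (x i) (s i) (y i).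
Proof. by rewrite /margY /Wn (sum_ffun_prod (fun i z => W (x i) (s i) (y i) z)). Qed.

Lemma margZ_Wn x s z :
  margZ (@Wn R S X Y Z W n) x s z = \prod_i margZ W (x i) (s i) (z i).
Proof. by rewrite /margZ /Wn (sum_ffun_prod (fun i y => W (x i) (s i) y (z i))). Qed.

(** Memorylessness: the channel from block codeword to block output is again a product, so the
    one-shot tails become tails of sums over letters. *)
Lemma outY_Wn :
  outY (@Wn R S X Y Z W n) (@extn R T S PST n) xfn = @extn R T Y (outY W PST xf) n.
Proof.
apply/funext => t; apply/funext => y; rewrite /outY /extn.
rewrite -(sum_ffun_prod (fun i s => PST (t i) s * margY W (xf (t i) s) s (y i))).
apply: eq_bigr => s _; rewrite margY_Wn big_split /=; congr (_ * _).
by apply: eq_bigr => i _; rewrite ffunE.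
Qed.

Lemma outZ_Wn :
  outZ (@Wn R S X Y Z W n) (@extn R T S PST n) xfn = @extn R T Z (outZ W PST xf) n.
Proof.
apply/funext => t; apply/funext => z; rewrite /outZ /extn.
rewrite -(sum_ffun_prod (fun i s => PST (t i) s * margZ W (xf (t i) s) s (z i))).
apply: eq_bigr => s _; rewrite margZ_Wn big_split /=; congr (_ * _).
by apply: eq_bigr => i _; rewrite ffunE.
Qed.

End Blocks.

(** The factors 2 absorb the rounding of codebook sizes to integers. *)
Lemma sqrt_ratio_le (R : realType) (n N : nat) (c d : R) : (0 < N)%N ->
  expR (n%:R * d) <= 2 * N%:R ->
  Num.sqrt (expR (n%:R * c) / N%:R) <= 2 * expR ((c - d) / 2) ^+ n.
Proof.
move=> N0 le; have NR : 0 < N%:R :> R by rewrite ltr0n.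
have e0 : 0 < 2 * expR ((c - d) / 2) ^+ n by rewrite mulr_gt0 // exprn_gt0 // expR_gt0.
rewrite -[leRHS]gtr0_norm // -sqrtr_sqr ler_wsqrtr // ler_pdivrMr //.
have -> : expR (n%:R * c) = expR ((c - d) / 2) ^+ n ^+ 2 * expR (n%:R * d).
  rewrite -exprM -expRM_natl -expRD; congr expR.
  by rewrite natrM; field.
rewrite exprMn (_ : 2 ^+ 2 * _ * _ = expR ((c - d) / 2) ^+ n ^+ 2 * (4 * N%:R)); last by ring.
rewrite ler_wpM2l ?exprn_ge0 ?expR_ge0 //; move: NR le; lra.
Qed.

(** A nonnegative rate makes [2^(n r)] at least 1, so truncation loses at most a factor 2. Rates are
    in bits, hence the [ln 2] in the exponent. *)
Lemma nmsg_bounds (R : realType) n (r : R) : 0 <= r ->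
  [/\ (0 < nmsg n r)%N, (nmsg n r)%:R <= expR (n%:R * (r * ln 2)) &
      expR (n%:R * (r * ln 2)) <= 2 * (nmsg n r)%:R].
Proof.
move=> r0.
have E : 2 `^ (n%:R * r) = expR (n%:R * (r * ln 2)) :> R.
  by rewrite /powR pnatr_eq0 /= mulrA.
have e1 : 1 <= expR (n%:R * (r * ln 2)).
  by rewrite -[leLHS]expR0 ler_expR; do 2!apply: mulr_ge0 => //; exact/ltW/ln2_gt0.
rewrite /nmsg E; set x := expR _ in e1 *.
have /andP[le gt] : (Num.truncn x)%:R <= x < (Num.truncn x).+1%:R.
  by apply: truncn_itv; lra.
have pos : (0 < Num.truncn x)%N.
  rewrite -(ltr0n R); move: gt; rewrite -natr1; case: (Num.truncn x) => [|k]; first lra.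
  by rewrite ltr0n.
split=> //; have : 1 <= (Num.truncn x)%:R :> R by rewrite ler1n.
move: gt; rewrite -natr1; lra.
Qed.

(** * Achievable rates *)

(** Exponential decay is recorded, rather than mere convergence, because passing from total
    variation to divergence costs a factor linear in [n]. *)
Definition exp_small (R : realType) (u : nat -> R) : Prop :=
  exists C g : R, [/\ 0 <= C, 0 < g < 1 & forall n, u n <= C * g ^+ n].

Section ExpSmall.
Variable R : realType.
Implicit Types u v : nat -> R.

Lemma exp_small_geometric u C (g : R) : 0 <= C -> 0 < g < 1 ->
  (forall n, u n <= C * g ^+ n) -> exp_small u.
Proof. by move=> C0 g01 ug; exists C, g. Qed.

Lemma exp_smallD u v : exp_small u -> exp_small v -> exp_small (fun n => u n + v n).
Proof.
move=> [C [g [C0 /andP[g0 g1] ug]]] [D [h [D0 /andP[h0 h1] vh]]].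
exists (C + D), (Num.max g h); split; first exact: addr_ge0.
  by rewrite lt_max g0 gt_max g1 h1.
move=> n; rewrite mulrDl; apply: lerD.
  apply: (le_trans (ug n)); rewrite ler_wpM2l // lerXn2r ?nnegrE ?le_max ?lexx //.
    exact: ltW.
  by rewrite (ltW g0).
apply: (le_trans (vh n)); rewrite ler_wpM2l // lerXn2r ?nnegrE ?le_max ?lexx ?orbT //.
  exact: ltW.
by rewrite (ltW g0).
Qed.

Lemma exp_smallZ u k : 0 <= k -> exp_small u -> exp_small (fun n => k * u n).
Proof.
move=> k0 [C [g [C0 g01 ug]]]; exists (k * C), g; split=> //; first exact: mulr_ge0.
by move=> n; rewrite -mulrA ler_wpM2l.
Qed.

(** Write [g] as [expR (- h) * expR (- h)]: one factor absorbs [n], by [n h <= expR (n h)], the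
    other keeps the decay. *)
Lemma exp_small_mul_nat u : exp_small u ->
  exp_small (fun n => n%:R * u n).
Proof.
move=> [C [g [C0 /andP[g0 g1] ug]]]; pose h := - ln g / 2.
have h0 : 0 < h by rewrite divr_gt0 // oppr_gt0 ln_lt0 // g0.
exists (C / h), (expR (- h)); split; first by rewrite divr_ge0 // ltW.
  by rewrite expR_gt0 expR_lt1 oppr_lt0.
move=> n /=; have gE : g = expR (- h) * expR (- h).
  have lnKg : expR (ln g) = g by rewrite lnK // posrE.
  by rewrite -expRD -[LHS]lnKg /h; congr expR; field.
apply: (le_trans (ler_wpM2l (ler0n _ _) (ug n))).
have key : n%:R * expR (- h) ^+ n <= h^-1.
  rewrite -expRM_natl mulrN expRN ler_pdivrMr ?expR_gt0 //.
  rewrite -(ler_pM2l h0) mulVKf ?gt_eqF //.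
  by apply: le_trans (expR_ge1Dx _); rewrite mulrC lerDr.
rewrite gE exprMn; set e := expR (- h) ^+ n in key *.
have -> : n%:R * (C * (e * e)) = C * e * (n%:R * e) by ring.
by rewrite [leRHS]mulrAC ler_wpM2l // mulr_ge0 // exprn_ge0 // expR_ge0.
Qed.

Lemma exp_small_cvg u v : exp_small v -> (forall n, 0 <= u n <= v n) ->
  (u n @[n --> \oo] --> 0)%classic.
Proof.
move=> [C [g [C0 /andP[g0 g1] ug]]] uv.
have gc : (geometric C g n @[n --> \oo] --> 0)%classic.
  by apply: cvg_geometric; rewrite gtr0_norm.
apply: (@squeeze_cvgr _ _ _ _ (fun=> 0) (geometric C g)) gc; last exact: cvg_cst.
by apply: nearW => n; case/andP: (uv n) => -> /= h; exact: (le_trans h (ug n)).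
Qed.

End ExpSmall.

(** * From one-shot bounds to achievable rates *)

Section Achievability.
Variables (R : realType) (T S X Y Z : finType) (W : X -> S -> Y -> Z -> R).
Variables (PT : T -> R) (PST : T -> S -> R) (xf : T -> S -> X).
Variables (QS : S -> R) (x0 : X).
Hypothesis W_channel : is_channel W.
Hypothesis PT_pmf : is_pmf PT.
Hypothesis PST_pmf : forall t, is_pmf (PST t).
Hypothesis QSE : forall s, QS s = \sum_t PT t * PST t s.
Notation QZ := (Q0 W QS x0).
Notation VY := (outY W PST xf).
Notation VZ := (outZ W PST xf).
Hypothesis QZE : forall z, QZ z = \sum_t PT t * VZ t z.
Notation PY := (fun y => \sum_t PT t * VY t y).

(** These are I(T;S), I(T;Y) and I(T;Z) in nats. *)
Definition infoS : R := \sum_t PT t * \sum_s PST t s * ln (PST t s / QS s).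
Definition infoY : R := \sum_t PT t * \sum_y VY t y * ln (VY t y / PY y).
Definition infoZ : R := \sum_t PT t * \sum_z VZ t z * ln (VZ t z / QZ z).

Let VY_pmf t : is_pmf (VY t) := outY_pmf xf W_channel PST_pmf t.
Let VZ_pmf t : is_pmf (VZ t) := outZ_pmf xf W_channel PST_pmf t.
Let QS_pmf : is_pmf QS := mixture_pmf PT_pmf PST_pmf QSE.
Let QZ_pmf : is_pmf QZ := mixture_pmf PT_pmf VZ_pmf QZE.

Lemma infoS_ge0 : 0 <= infoS.
Proof.
apply: sumr_ge0 => t _; have [->|PTt] := eqVneq (PT t) 0; first by rewrite mul0r.
rewrite mulr_ge0 ?PT_pmf.1 // gibbs // => s.
by apply: (mixture_gt0 PT_pmf PST_pmf QSE); rewrite lt0r PTt PT_pmf.1.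
Qed.

(* [QS s * margZ W (xf t s) s z / QZ z <= (VZ t z / QZ z) / (PST t s / QS s)],
   and the log of the right-hand side has mean [infoZ - infoS]. *)
Lemma derandomization_tail (c : R) : infoZ - infoS < c ->
  exists2 g : R, 0 < g < 1 & forall n,
  \sum_t @QSn R T PT n t * \sum_s extn PST t s *
    \sum_z (if expR (n%:R * c) * Q0n W QS x0 z <
               QSn QS s * margZ (@Wn R S X Y Z W n) (xfn xf t s) s z
            then margZ (@Wn R S X Y Z W n) (xfn xf t s) s z else 0) <= g ^+ n.
Proof.
move=> lc.
pose mZ t s z := margZ W (xf t s) s z.
have mZ0 t s z : 0 <= mZ t s z by exact: margZ_ge0.
have mZ1 t s : \sum_z mZ t s z = 1 by exact: margZ_sum1.
pose V t (sz : S * Z) := PST t sz.1 * mZ t sz.1 sz.2.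
have V_pmf t : is_pmf (V t).
  split=> [sz|]; first by rewrite mulr_ge0 ?(PST_pmf t).1.
  rewrite -(pair_bigA _ (fun s z => PST t s * mZ t s z)) /= -(PST_pmf t).2.
  by apply: eq_bigr => s _; rewrite -mulr_sumr mZ1 mulr1.
pose l t (sz : S * Z) := ln (VZ t sz.2 / QZ sz.2) - ln (PST t sz.1 / QS sz.1).
have lE : \sum_t PT t * \sum_sz V t sz * l t sz = infoZ - infoS.
  rewrite /infoZ /infoS -sumrB; apply: eq_bigr => t _; rewrite -mulrBr; congr (_ * _).
  rewrite -(pair_bigA _ (fun s z => V t (s, z) * l t (s, z))) /=.
  under eq_bigr do under eq_bigr do rewrite mulrBr.
  under eq_bigr do rewrite sumrB.
  rewrite sumrB; congr (_ - _).
    by rewrite exchange_big; apply: eq_bigr => z _ /=; rewrite -mulr_suml.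
  apply: eq_bigr => s _ /=; rewrite -mulr_suml /V /= -mulr_sumr mZ1 mulr1 //.
rewrite -lE in lc; have [g g01 H] := pair_tail PT_pmf V_pmf lc.
exists g => // n.
pose E (t : {ffun 'I_n -> T}) (w : {ffun 'I_n -> S * Z}) :=
  let s := [ffun i => (w i).1] in let z := [ffun i => (w i).2] in
  expR (n%:R * c) * Q0n W QS x0 z <
               QSn QS s * margZ (@Wn R S X Y Z W n) (xfn xf t s) s z.
have := H n E => {}H; apply: le_trans (H _).
  apply: ler_sum => t _; rewrite ler_wpM2l ?(QSn_pmf n PT_pmf).1 //.
  under eq_bigr do rewrite mulr_sumr.
  rewrite sum_ffun_pair; apply: ler_sum => w _; rewrite /E /=.
  case: ifP => _; last by rewrite mulr0.
  rewrite margZ_Wn /extn -big_split /=; apply: ler_prod => i _.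
  by rewrite !ffunE /V lexx mulr_ge0 ?mZ0 ?(PST_pmf _).1.
move=> t w; rewrite /E /= margZ_Wn => big PT0 V0.
have PST0 i : 0 < PST (t i) (w i).1.
  move: (V0 i); rewrite /V !lt0r mulf_eq0 negb_or (PST_pmf _).1 andbT.
  by move=> /andP[/andP[]].
have mZp i : 0 < mZ (t i) (w i).1 (w i).2.
  by move: (V0 i); rewrite /V !lt0r mulf_eq0 negb_or mZ0 andbT => /andP[/andP[]].
have QS0 i : 0 < QS (w i).1 by exact: (mixture_gt0 PT_pmf PST_pmf QSE (PT0 i)).
have VZge i : PST (t i) (w i).1 * mZ (t i) (w i).1 (w i).2 <= VZ (t i) (w i).2.
  rewrite /outZ (bigD1 (w i).1) //= lerDl sumr_ge0 // => s _.
  by rewrite mulr_ge0 ?(PST_pmf _).1 // mZ0.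
have VZ0 i : 0 < VZ (t i) (w i).2 by apply: lt_le_trans (VZge i); exact: mulr_gt0.
have QZ0 i : 0 < QZ (w i).2 by exact: (mixture_gt0 PT_pmf VZ_pmf QZE (PT0 i)).
(* Chosen so that [v i / QZ] is the exponential of [l]; it dominates [QS * mZ] by [VZge]. *)
pose v i := VZ (t i) (w i).2 * QS (w i).1 / PST (t i) (w i).1.
have v0 i : 0 < v i by rewrite divr_gt0 // mulr_gt0.
rewrite (eq_bigr (fun i => ln (v i / QZ (w i).2))); last first.
  move=> i _; rewrite /l -ln_div ?posrE ?divr_gt0 //; congr ln.
  by rewrite /v; field; rewrite !gt_eqF.
rewrite -ler_expR expR_sum_ln_ratio // ler_pdivlMr ?prodr_gt0 //.
move/ltW: big; rewrite {1}/Q0n; under [X in _ * X <= _]eq_bigr do rewrite ffunE.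
move=> /le_trans; apply; rewrite /QSn -big_split; apply: ler_prod => i _ /=.
rewrite !ffunE mulr_ge0 ?mZ0 ?(ltW (QS0 i)) //= /v ler_pdivlMr //.
by rewrite -mulrA mulrC ler_pM2r // mulrC.
Qed.

Lemma block_codes (r : R) : 0 <= r -> infoZ - infoS < r * ln 2 < infoY - infoS ->
  exists2 u : nat -> R, exp_small u & forall n,
  exists (f : 'I_(nmsg n r) -> {ffun 'I_n -> S} -> {ffun 'I_n -> X})
         (g : {ffun 'I_n -> Y} -> 'I_(nmsg n r)),
    err_prob W QS f g + \sum_z `|PZn W QS f z - Q0n W QS x0 z| <= u n.
Proof.
move=> r0 /andP[]; set r2 := r * ln 2 => lo hi; have a0 := infoS_ge0.
have r20 : 0 <= r2 by rewrite mulr_ge0 // ltW // ln2_gt0.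
(* [rho] is the rate of [J] in nats, the midpoint of the window from [infoS] to [infoY - r2]. *)
pose rho := (infoS + (infoY - r2)) / 2.
have rho1 : infoS < rho by rewrite /rho; lra.
have rho2 : r2 + rho < infoY by rewrite /rho; lra.
(* Each threshold exponent separates an information quantity from a codebook rate: [c1] lies between
   [infoZ] and [r2 + rho], [c2] between [infoS] and [rho], [c3] between [r2 + rho] and [infoY], [c4]
   between [infoZ - infoS] and [r2]. *)
pose c1 := r2 + infoS; pose c2 := (infoS + rho) / 2.
pose c3 := (r2 + rho + infoY) / 2; pose c4 := (infoZ - infoS + r2) / 2.
have h1 : infoZ < c1 by rewrite /c1; lra.
have h2 : infoS < c2 by rewrite /c2; lra.
have h3 : c3 < infoY by rewrite /c3; lra.
have h4 : infoZ - infoS < c4 by rewrite /c4; lra.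
have [g1 g1P t1] := tail_gt_exponential PT_pmf VZ_pmf QZE h1.
have [g2 g2P t2] := tail_gt_exponential PT_pmf PST_pmf QSE h2.
have [g3 g3P t3] := tail_lt_exponential PT_pmf VY_pmf (fun=> erefl) h3.
have [g4 g4P t4] := derandomization_tail h4.
have e01 x : x < 0 -> 0 < expR x < 1 by move=> xn; rewrite expR_gt0 expR_lt1.
have b1 : 0 < expR ((c1 - (r2 + rho)) / 2) < 1 by apply: e01; rewrite /c1; lra.
have b2 : 0 < expR ((c2 - rho) / 2) < 1 by apply: e01; rewrite /c2; lra.
have b3 : 0 < expR (r2 + rho - c3) < 1 by apply: e01; rewrite /c3; lra.
have b4 : 0 < expR ((c4 - r2) / 2) < 1 by apply: e01; rewrite /c4; lra.
(* The successor gives [J n] the lower bound [expR (n%:R * rho)] needed for covering; decoding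
   tolerates twice that value. *)
pose K n := nmsg n r; pose J n := (Num.truncn (expR (n%:R * rho))).+1.
exists (fun n =>
    (g3 ^+ n + 2 * expR (r2 + rho - c3) ^+ n) +
    4 * (2 * g2 ^+ n + 2 * expR ((c2 - rho) / 2) ^+ n) +
    (2 * g1 ^+ n + 2 * expR ((c1 - (r2 + rho)) / 2) ^+ n) +
    (2 * g4 ^+ n + 2 * expR ((c4 - r2) / 2) ^+ n)).
  have geo g : 0 < g < 1 -> exp_small (fun n => g ^+ n).
    by move=> gP; apply: (exp_small_geometric ler01 gP) => n; rewrite mul1r.
  have geo2 g : 0 < g < 1 -> exp_small (fun n => 2 * g ^+ n).
    by move=> gP; apply: exp_smallZ => //; exact: geo.
  have two g h : 0 < g < 1 -> 0 < h < 1 -> exp_small (fun n => 2 * g ^+ n + 2 * h ^+ n).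
    by move=> gP hP; apply: exp_smallD; exact: geo2.
  apply: exp_smallD; last exact: two; apply: exp_smallD; last exact: two.
  apply: exp_smallD; last by apply: exp_smallZ => //; exact: two.
  by apply: exp_smallD; [exact: geo | exact: geo2].
move=> n.
have [K0 Kle Kge] := nmsg_bounds n r0; rewrite -/(K n) -/r2 in K0 Kle Kge *.
have rho0 : 0 <= rho by lra.
have er1 : 1 <= expR (n%:R * rho) by rewrite -[leLHS]expR0 ler_expR mulr_ge0.
have [Jge Jle] : expR (n%:R * rho) <= (J n)%:R /\ (J n)%:R <= 2 * expR (n%:R * rho).
  have /andP[le gt] := truncn_itv (expR_ge0 (n%:R * rho)).
  split; first exact: ltW.
  by move: le; rewrite /J -natr1; lra.
have J0 : (0 < J n)%N by [].
have KJ0 : (0 < K n * J n)%N by rewrite muln_gt0 K0.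
have PSTn t : is_pmf (@extn R T S PST n t) by exact: extn_pmf.
have QSnE s : @QSn R S QS n s = \sum_t QSn PT t * extn PST t s.
  exact: extn_mixture.
have PYnE y : @QSn R Y PY n y =
    \sum_t QSn PT t * outY (@Wn R S X Y Z W n) (@extn R T S PST n) (@xfn T S X xf n) t y.
  by rewrite outY_Wn; exact: extn_mixture.
have QZnE z : @Q0n R S X Y Z W QS x0 n z =
    \sum_t QSn PT t * outZ (@Wn R S X Y Z W n) (@extn R T S PST n) (@xfn T S X xf n) t z.
  by rewrite outZ_Wn; exact: (@extn_mixture R T Z PT VZ QZ).
have e0 c : 0 < expR (n%:R * c) :> R by exact: expR_gt0.
have [f [g]] := one_shot_code (Wn_channel n W_channel) (QSn_pmf n PT_pmf) PSTn
  QSnE PYnE QZnE K0 J0 (e0 c1) (e0 c2) (e0 c3) (e0 c4).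
rewrite outY_Wn outZ_Wn => le; exists f, g; apply: (le_trans le).
have s1 : Num.sqrt (expR (n%:R * c1) / (K n * J n)%:R) <=
    2 * expR ((c1 - (r2 + rho)) / 2) ^+ n.
  apply: sqrt_ratio_le => //; rewrite mulrDr expRD natrM mulrA.
  by apply: ler_pM => //; exact: expR_ge0.
have s2 : Num.sqrt (expR (n%:R * c2) / (J n)%:R) <= 2 * expR ((c2 - rho) / 2) ^+ n.
  by apply: sqrt_ratio_le => //; apply: (le_trans Jge); rewrite ler_peMl // ler1n.
have s4 : Num.sqrt (expR (n%:R * c4) / (K n)%:R) <= 2 * expR ((c4 - r2) / 2) ^+ n.
  exact: sqrt_ratio_le.
have s3 : (K n * J n)%:R / expR (n%:R * c3) <= 2 * expR (r2 + rho - c3) ^+ n.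
  rewrite ler_pdivrMr // -expRM_natl -mulrA -expRD natrM.
  have -> : n%:R * (r2 + rho - c3) + n%:R * c3 = n%:R * r2 + n%:R * rho by ring.
  by rewrite expRD mulrCA; apply: ler_pM.
have := t1 n; have := t2 n; have := t3 n; have := t4 n.
move=> t4n t3n t2n t1n.
apply: lerD; last by apply: lerD => //; rewrite ler_pM2l.
apply: lerD; last by apply: lerD => //; rewrite ler_pM2l.
apply: lerD; first exact: lerD.
by rewrite ler_pM2l //; apply: lerD => //; rewrite ler_pM2l.
Qed.

Lemma PZn_pmf n K (f : 'I_K -> {ffun 'I_n -> S} -> {ffun 'I_n -> X}) :
  (0 < K)%N -> is_pmf (@PZn R S X Y Z W QS n K f).
Proof.
move=> K0; have [W0 W1] := Wn_channel n W_channel; have [Q0' Q1] := QSn_pmf n QS_pmf.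
have KR : K%:R != 0 :> R by rewrite pnatr_eq0 -lt0n.
split=> [z|].
  rewrite mulr_ge0 // sumr_ge0 // => m _; rewrite sumr_ge0 // => s _.
  by rewrite mulr_ge0 // sumr_ge0.
rewrite -mulr_sumr exchange_big /= (eq_bigr (fun=> 1)).
  by rewrite sumr_const card_ord mulVf.
move=> m _; rewrite exchange_big -Q1; apply: eq_bigr => s _ /=.
by rewrite -mulr_sumr exchange_big W1 mulr1.
Qed.

Lemma err_prob_ge0 n K (f : 'I_K -> {ffun 'I_n -> S} -> {ffun 'I_n -> X}) g :
  0 <= @err_prob R S X Y Z W QS n K f g.
Proof.
have [W0 W1] := Wn_channel n W_channel; have [Q0' Q1] := QSn_pmf n QS_pmf.
rewrite mulr_ge0 // sumr_ge0 // => m _; rewrite sumr_ge0 // => s _.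
rewrite mulr_ge0 // sumr_ge0 // => y _; rewrite sumr_ge0 // => z _.
by case: ifP.
Qed.

Lemma achievable_of_info (r : R) : (forall z, 0 < QZ z) -> 0 <= r ->
  infoZ - infoS < r * ln 2 < infoY - infoS -> achievable W QS x0 r.
Proof.
move=> QZ0 r0 hr; split=> //; have [u us codes] := block_codes r0 hr.
(* [cid] chooses one good code per block length. *)
have {}codes n : {f : ('I_(nmsg n r) -> {ffun 'I_n -> S} -> {ffun 'I_n -> X}) *
     ({ffun 'I_n -> Y} -> 'I_(nmsg n r)) |
    err_prob W QS f.1 f.2 + \sum_z `|PZn W QS f.1 z - Q0n W QS x0 z| <= u n}.
  by apply: cid; have [f [g]] := codes n; exists (f, g).
pose tv n := \sum_z `|PZn W QS (sval (codes n)).1 z - @Q0n R S X Y Z W QS x0 n z|.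
have tv0 n : 0 <= tv n by apply: sumr_ge0.
exists (fun n => (sval (codes n)).1), (fun n => (sval (codes n)).2); split.
  apply: (exp_small_cvg us) => n; rewrite err_prob_ge0 /=.
  by apply: le_trans (svalP (codes n)); rewrite lerDl; exact: tv0.
have tvu n : tv n <= u n.
  by apply: le_trans (svalP (codes n)); rewrite lerDr err_prob_ge0.
(* All factors lie in [(0, 1]], so their product is a positive lower bound for each of them. *)
pose q := \prod_z QZ z.
have q0 : 0 < q by apply: prodr_gt0.
have QZ1 z : QZ z <= 1 by rewrite -QZ_pmf.2 (bigD1 z) //= lerDl sumr_ge0 // => *; exact: ltW.
have q1 : q <= 1 by apply: prodr_ile1 => z _; rewrite (ltW (QZ0 z)) QZ1.
have qQ z : q <= QZ z.
  rewrite /q (bigD1 z) //= ler_piMr ?(ltW (QZ0 z)) //.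
  by apply: prodr_ile1 => i _; rewrite (ltW (QZ0 i)) QZ1.
have lq : 0 <= - ln q by rewrite oppr_ge0 ln_le0.
have l2 := ln2_gt0 R.
(* The block law is at least [q ^+ n], so [KL_le_tv] has the prefactor [(1 - n ln q) / ln 2]; its
   linear growth is harmless against exponential decay. *)
apply: (@exp_small_cvg _ _ (fun n => (ln 2)^-1 * u n + (- ln q / ln 2) * (n%:R * u n))).
  apply: exp_smallD; apply: exp_smallZ => //; rewrite ?invr_ge0 ?(ltW l2) //.
    by rewrite divr_ge0 // ltW.
  exact: exp_small_mul_nat.
move=> n; have [K0 _ _] := nmsg_bounds n r0.
have Qnp := QSn_pmf n QZ_pmf.
rewrite KL_ge0 //=; last 2 first.
- exact: PZn_pmf.
- by move=> z; apply: prodr_gt0.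
have qn : 0 < q ^+ n <= 1 by rewrite exprn_gt0 // exprn_ile1 // ltW.
have qnQ z : q ^+ n <= @Q0n R S X Y Z W QS x0 n z.
  rewrite -[n in q ^+ n]card_ord -prodr_const; apply: ler_prod => i _.
  by rewrite qQ ltW.
apply: (le_trans (KL_le_tv (PZn_pmf _ K0) qn qnQ)).
rewrite lnXn // -[ln q *+ n]mulr_natl -/(tv n).
rewrite [leRHS](_ : _ = (1 - n%:R * ln q) / ln 2 * u n); last by rewrite /=; ring.
rewrite ler_wpM2l // divr_ge0 ?(ltW l2) // -mulrN addr_ge0 // mulr_ge0 //.
Qed.

End Achievability.

(** * Mutual information and the capacity bound *)

Section Information.
Variables (R : realType) (Om A B C : finType) (p : Om -> R).
Hypothesis p0 : forall w, 0 <= p w.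

Lemma pmassE (E : pred Om) : pmass p E = \sum_w p w * (E w)%:R.
Proof.
rewrite /pmass big_mkcond; apply: eq_bigr => w _.
by case: (E w); rewrite ?mulr1 ?mulr0.
Qed.

Lemma pmass_gt0 (E : pred Om) w : 0 < p w -> E w -> 0 < pmass p E.
Proof.
by move=> pw Ew; rewrite /pmass (bigD1 w) //= ltr_pwDl // sumr_ge0.
Qed.

(** Holds term by term: wherever [p w > 0] all the masses involved are positive, the logarithms add
    and the ratios cancel. *)
Lemma MI_chain (f : Om -> A) (h : Om -> C) (g : Om -> B) :
  MI p (fun w => (f w, h w)) g = MI p f g + condMI p h g f.
Proof.
rewrite /MI /condMI -big_split; apply: eq_bigr => w _ /=.
have [->|pw] := eqVneq (p w) 0; first by rewrite !mul0r addr0.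
have {pw} pw : 0 < p w by rewrite lt0r pw p0.
rewrite -mulrDr; congr (_ * _); rewrite /log2 -mulrDl; congr (_ / _).
have pos (E : pred Om) : E w -> pmass p E \is Num.pos.
  by move=> Ew; rewrite posrE (pmass_gt0 pw).
rewrite -lnM; last 2 first.
- by rewrite rpredM ?rpredV ?rpredM ?pos ?eqxx.
- by rewrite rpredM ?rpredV ?rpredM ?pos ?eqxx.
congr ln.
have e1 : pmass p (fun t' => [&& (f t', h t') == (f w, h w), g t' == g w & tt == tt])
   = pmass p (fun t' => [&& h t' == h w, g t' == g w & f t' == f w]).
  apply: eq_bigl => t; rewrite xpair_eqE andbT andbC andbA andbC.
  by case: (f t == f w); case: (h t == h w); case: (g t == g w).
have e2 : pmass p (fun t' => ((f t', h t') == (f w, h w)) && (tt == tt))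
   = pmass p (fun t' => (h t' == h w) && (f t' == f w)).
  by apply: eq_bigl => t; rewrite xpair_eqE andbT andbC.
have e3 : pmass p (fun t' => [&& f t' == f w, g t' == g w & tt == tt])
   = pmass p (fun t' => (g t' == g w) && (f t' == f w)).
  by apply: eq_bigl => t; rewrite andbT andbC.
have e4 : pmass p (fun t' => (f t' == f w) && (tt == tt)) = pmass p (fun t' => f t' == f w).
  by apply: eq_bigl => t; rewrite andbT.
rewrite e1 e2 e3 e4.
have ne (E : pred Om) : E w -> pmass p E != 0.
  by move=> Ew; rewrite gt_eqF // (pmass_gt0 pw).
by field; rewrite !ne ?eqxx.
Qed.

(** The joint law is supplied through test functions [F]: indicators yield each marginal mass, and
    the log-ratio itself yields the final sum. *)
Lemma MI_of_joint (f : Om -> A) (g : Om -> B) (a : A -> R) (V : A -> B -> R) (q : B -> R) :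
  is_pmf a -> (forall x, is_pmf (V x)) -> (forall y, q y = \sum_x a x * V x y) ->
  (forall F : A -> B -> R,
     \sum_w p w * F (f w) (g w) = \sum_x a x * \sum_y V x y * F x y) ->
  MI p f g = (\sum_x a x * \sum_y V x y * ln (V x y / q y)) / ln 2.
Proof.
move=> ap Vp qE joint.
have V1 x := (Vp x).2.
have m1 : pmass p (fun _ => tt == tt) = 1.
  rewrite pmassE (joint (fun _ _ => 1)) -[RHS]ap.2; apply: eq_bigr => x _.
  by under eq_bigr do rewrite mulr1; rewrite V1 mulr1.
have mf x : pmass p (fun w => (f w == x) && (tt == tt)) = a x.
  rewrite pmassE (joint (fun x' _ => ((x' == x) && (tt == tt))%:R)) (bigD1 x) //=.
  rewrite !eqxx [X in _ + X]big1 ?addr0 => [|x' /negbTE ->]; last first.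
    by rewrite big1 ?mulr0 // => y _; rewrite mulr0.
  by under eq_bigr do rewrite mulr1; rewrite V1 mulr1.
have mg y : pmass p (fun w => (g w == y) && (tt == tt)) = q y.
  rewrite pmassE (joint (fun _ y' => ((y' == y) && (tt == tt))%:R)) qE.
  apply: eq_bigr => x _; rewrite (bigD1 y) //= eqxx mulr1 big1 ?addr0 //.
  by move=> y' /negbTE ->; rewrite mulr0.
have mfg x y : pmass p (fun w => [&& f w == x, g w == y & tt == tt]) = a x * V x y.
  rewrite pmassE (joint (fun x' y' => [&& x' == x, y' == y & tt == tt]%:R)).
  rewrite (bigD1 x) //= [X in _ + X]big1 ?addr0 => [|x' /negbTE ->]; last first.
    by rewrite big1 ?mulr0 // => y' _; rewrite mulr0.
  congr (_ * _); rewrite (bigD1 y) //= !eqxx mulr1 big1 ?addr0 //.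
  by move=> y' /negbTE ->; rewrite andbF mulr0.
rewrite /MI /condMI.
under eq_bigr do rewrite mfg m1 mf mg.
rewrite (joint (fun x y => log2 (a x * V x y * 1 / (a x * q y)))) mulr_suml.
apply: eq_bigr => x _; have [->|ax] := eqVneq (a x) 0; first by rewrite !mul0r.
rewrite -mulrA mulr_suml; congr (_ * _); apply: eq_bigr => y _.
by rewrite /log2 mulr1 -mulf_div mulfV // mul1r mulrA.
Qed.

End Information.

(** * The pair (U, V) as a single auxiliary variable *)

Section Joint.
Variables (R : realType) (S X Y Z : finType) (W : X -> S -> Y -> Z -> R).
Variables (nu nv : nat) (PU : 'I_nu -> R) (PV : 'I_nv -> R).
Variables (PSUV : 'I_nu -> 'I_nv -> S -> R) (xf : 'I_nu -> S -> X).
Hypothesis W_channel : is_channel W.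

Definition auxP (t : 'I_nu * 'I_nv) : R := PU t.1 * PV t.2.
Definition auxPS (t : 'I_nu * 'I_nv) : S -> R := PSUV t.1 t.2.
Definition auxX (t : 'I_nu * 'I_nv) : S -> X := xf t.1.
Notation P := (jointP W PU PV PSUV xf).
Notation UV := (@rvUV S X Y Z nu nv).

(** Common source of the laws of (T,S), (T,Y) and (T,Z): the indicator in [jointP] collapses the sum
    over [x]. *)
Lemma sum_jointP (F : 'I_nu * 'I_nv -> S -> Y -> Z -> R) :
  \sum_t P t * F (UV t) (rvS t) (rvY t) (rvZ t) =
  \sum_t auxP t * \sum_s auxPS t s *
    \sum_y \sum_z W (auxX t s) s y z * F t s y z.
Proof.
have -> : \sum_t P t * F (UV t) (rvS t) (rvY t) (rvZ t) =
    \sum_t \sum_s \sum_x \sum_y \sum_z P (t, s, x, y, z) * F t s y z.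
  by rewrite 4!pair_bigA; apply: eq_bigr => -[[[[[u v] s] x] y] z].
apply: eq_bigr => -[u v] _; rewrite mulr_sumr; apply: eq_bigr => s _ /=.
rewrite (bigD1 (xf u s)) //= [X in _ + X]big1 ?addr0 => [|x /negbTE xn]; last first.
  by rewrite big1 // => y _; rewrite big1 // => z _; rewrite xn mulr0 !mul0r.
rewrite !mulr_sumr; apply: eq_bigr => y _; rewrite !mulr_sumr; apply: eq_bigr => z _.
by rewrite eqxx mulr1 /auxP /auxPS /auxX /=; ring.
Qed.

Lemma joint_S (F : 'I_nu * 'I_nv -> S -> R) :
  \sum_t P t * F (UV t) (rvS t) = \sum_t auxP t * \sum_s auxPS t s * F t s.
Proof.
rewrite (sum_jointP (fun t s _ _ => F t s)); apply: eq_bigr => t _; congr (_ * _).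
apply: eq_bigr => s _; congr (_ * _).
under eq_bigr do rewrite -mulr_suml.
by rewrite -mulr_suml W_channel.2 mul1r.
Qed.

Lemma joint_Y (F : 'I_nu * 'I_nv -> Y -> R) :
  \sum_t P t * F (UV t) (rvY t) =
  \sum_t auxP t * \sum_y outY W auxPS auxX t y * F t y.
Proof.
rewrite (sum_jointP (fun t _ y _ => F t y)); apply: eq_bigr => t _; congr (_ * _).
under [RHS]eq_bigr do rewrite /outY mulr_suml.
rewrite [RHS]exchange_big; apply: eq_bigr => s _ /=.
by rewrite mulr_sumr; apply: eq_bigr => y _; rewrite -mulr_suml mulrA.
Qed.

Lemma joint_Z (F : 'I_nu * 'I_nv -> Z -> R) :
  \sum_t P t * F (UV t) (rvZ t) =
  \sum_t auxP t * \sum_z outZ W auxPS auxX t z * F t z.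
Proof.
rewrite (sum_jointP (fun t _ _ z => F t z)); apply: eq_bigr => t _; congr (_ * _).
under [RHS]eq_bigr do rewrite /outZ mulr_suml.
rewrite [RHS]exchange_big; apply: eq_bigr => s _ /=.
rewrite exchange_big mulr_sumr.
by apply: eq_bigr => z _; rewrite -mulr_suml mulrA.
Qed.

End Joint.

(** * The zero rate *)

Section ZeroRate.
Variables (R : realType) (S X Y Z : finType) (W : X -> S -> Y -> Z -> R).
Variables (QS : S -> R) (x0 : X).

(** Always sending [x0] produces exactly the law [Q0] at the warden, and at rate zero the only
    message cannot be mistaken. *)
Lemma achievable0 : (forall z, 0 < Q0 W QS x0 z) -> achievable W QS x0 0.
Proof.
move=> Q00; split=> //.
have K1 n : nmsg n 0 = 1%N :> nat by rewrite /nmsg mulr0 powRr0 truncn1.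
have one n : (0 < nmsg n (0 : R))%N by rewrite K1.
pose f n (_ : 'I_(nmsg n (0 : R))) (_ : {ffun 'I_n -> S}) : {ffun 'I_n -> X} := [ffun=> x0].
pose g n (_ : {ffun 'I_n -> Y}) : 'I_(nmsg n (0 : R)) := Ordinal (one n).
exists f, g; split.
  rewrite (_ : (fun n => _) = fun=> 0); first exact: cvg_cst.
  apply/funext => n; rewrite /err_prob big1 ?mulr0 // => m _.
  rewrite big1 // => s _; rewrite big1 ?mulr0 // => y _; rewrite big1 // => z _.
  case: eqP => // ne; case: ne; apply: val_inj => /=.
  by case: m => m /=; rewrite K1 ltnS leqn0 => /eqP.
have PZE n z : PZn W QS (f n) z = Q0n W QS x0 z.
  rewrite /PZn (eq_bigr (fun=> Q0n W QS x0 z)) => [|m _].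
    by rewrite sumr_const card_ord K1 invr1 mul1r.
  rewrite /Q0n /Q0 -(sum_ffun_prod (fun i s => QS s * \sum_y W x0 s y (z i))).
  apply: eq_bigr => s _; rewrite big_split /=; congr (_ * _).
  rewrite /Wn -(sum_ffun_prod (fun i y => W x0 (s i) y (z i))).
  by apply: eq_bigr => y _; apply: eq_bigr => i _; rewrite ffunE.
rewrite (_ : (fun n => _) = fun=> 0); first exact: cvg_cst.
apply/funext => n; rewrite /KL big1 // => z _; rewrite PZE.
case: eqP => // /eqP ne; by rewrite /log2 mulfV // ln1 mul0r mulr0.
Qed.

End ZeroRate.

Theorem theorem4 (R : realType) (S X Y Z : finType)
  (W : X -> S -> Y -> Z -> R) (QS : S -> R) (x0 : X) :
  is_channel W -> is_pmf QS ->
  (forall z, 0 < Q0 W QS x0 z) ->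
  forall r : R, rate_set W QS x0 r ->
    (r%:E <= covert_capacity W QS x0)%E.
Proof.
move=> Wc QSp QZ0 r [r0 [nu [nv [PU [PV [PSUV [xf [D rle]]]]]]]].
have sup s : achievable W QS x0 s -> (s%:E <= covert_capacity W QS x0)%E.
  by move=> sa; apply: ereal_sup_ubound; exists s.
(* At [r = 0] the gap [b - a] may be zero, which leaves no room for a rate strictly below it. *)
have [->|rn0] := eqVneq r 0; first exact/sup/achievable0.
have rp : 0 < r by rewrite lt0r rn0.
move: D rle; rewrite /in_D; set P := jointP W PU PV PSUV xf.
move=> [_ [_ [[PU0 PU1] [[PV0 PV1] [PSp [QSE [PZE cond]]]]]]] rle.
pose PT := @auxP R nu nv PU PV; pose PS := @auxPS R S nu nv PSUV.
pose xt := @auxX S X nu nv xf.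
have PTp : is_pmf PT.
  split=> [t|]; first exact: mulr_ge0.
  rewrite -(pair_bigA _ (fun u v => PU u * PV v)) /= -PU1.
  by apply: eq_bigr => u _; rewrite -mulr_sumr PV1 mulr1.
have PSTp t : is_pmf (PS t) by exact: PSp.
have P0 t : 0 <= P t.
  case: t => [[[[[u v] s] x] y] z]; rewrite /P /=.
  rewrite mulr_ge0 ?Wc.1 // mulr_ge0 //; last by case: ifP.
  by rewrite !mulr_ge0 ?(PSp u v).1.
have QSE' s : QS s = \sum_t PT t * PS t s.
  by rewrite QSE -(pair_bigA _ (fun u v => PU u * PV v * PSUV u v s)).
have QZE z : Q0 W QS x0 z = \sum_t PT t * outZ W PS xt t z.
  rewrite -PZE pmassE (joint_Z W PU PV PSUV xf (fun _ z' => (z' == z)%:R)).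
  apply: eq_bigr => t _; rewrite (bigD1 z) //= eqxx mulr1 big1 ?addr0 //.
  by move=> z' /negbTE ->; rewrite mulr0.
have VYp t : is_pmf (outY W PS xt t) by exact: outY_pmf.
have VZp t : is_pmf (outZ W PS xt t) by exact: outZ_pmf.
have l2 := ln2_gt0 R.
set a := infoS PT PS QS; set b := infoY W PT PS xt; set c := infoZ W PT PS xt QS x0.
have Ia : MI P (@rvUV S X Y Z nu nv) (@rvS S X Y Z nu nv) = a / ln 2.
  by apply: MI_of_joint => // F; exact: joint_S.
have Ic : MI P (@rvUV S X Y Z nu nv) (@rvZ S X Y Z nu nv) = c / ln 2.
  by apply: MI_of_joint => // F; exact: joint_Z.
have Ib : MI P (@rvU S X Y Z nu nv) (@rvY S X Y Z nu nv) +
    condMI P (@rvV S X Y Z nu nv) (@rvY S X Y Z nu nv) (@rvU S X Y Z nu nv) = b / ln 2.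
  by rewrite -MI_chain //; apply: MI_of_joint => // F; exact: joint_Y.
(* Second entry of the maximum in the condition of [in_D], combined with the chain rule. *)
have cb : c < b.
  rewrite -(ltr_pM2r (_ : 0 < (ln 2)^-1)) ?invr_gt0 // -Ib -Ic.
  by move: cond; rewrite gt_max => /andP[_]; lra.
have rab : r <= (b - a) / ln 2.
  apply: (le_trans rle); rewrite mulrBl -Ib -Ia.
  have : MI P (@rvUV S X Y Z nu nv) (@rvS S X Y Z nu nv) -
     condMI P (@rvV S X Y Z nu nv) (@rvY S X Y Z nu nv) (@rvU S X Y Z nu nv) <=
     Num.max (MI P (@rvU S X Y Z nu nv) (@rvS S X Y Z nu nv))
       (MI P (@rvUV S X Y Z nu nv) (@rvS S X Y Z nu nv) -
        condMI P (@rvV S X Y Z nu nv) (@rvY S X Y Z nu nv) (@rvU S X Y Z nu nv)).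
    by rewrite le_max lexx orbT.
  lra.
have hi0 : 0 < b - a.
  by move: (lt_le_trans rp rab); rewrite pmulr_lgt0 // invr_gt0.
(* [r] may sit at the edge of the achievable window, so a rate within [e] of it is used instead. *)
apply/lee_addgt0Pr => e e0.
pose lo := Num.max 0 (c - a).
have lo1 : lo < b - a by rewrite gt_max hi0; lra.
have lo2 : 0 <= lo by rewrite le_max lexx.
have lo3 : c - a <= lo by rewrite le_max lexx orbT.
(* The first entry puts [s] within [e * ln 2] of [b - a]; the midpoint keeps it above [lo] when [e]
   is large. *)
pose s := Num.max (b - a - e * ln 2) ((lo + (b - a)) / 2).
have el : 0 < e * ln 2 by rewrite mulr_gt0.
have s1 : lo < s by rewrite lt_max; apply/orP; right; lra.
have s2 : s < b - a by rewrite gt_max; apply/andP; split; lra.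
have s3 : b - a - e * ln 2 <= s by rewrite le_max lexx.
have sr : s / ln 2 * ln 2 = s by rewrite divfK // gt_eqF.
apply: (@le_trans _ _ (s / ln 2 + e)%:E).
  rewrite lee_fin; apply: (le_trans rab).
  rewrite -(ler_pM2r l2) divfK ?gt_eqF // mulrDl sr; lra.
rewrite EFinD leeD2r //; apply: sup.
apply: (@achievable_of_info R _ S X Y Z W PT PS xt) => //.
  by rewrite divr_ge0 ?(ltW l2) // (le_trans lo2) // ltW.
by rewrite sr -/a -/b -/c; apply/andP; split; lra.
Qed.
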